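(* Let $M$ be a compact connected manifold, let $(g(t))_{t\in[0,T_c[}$ be a solution of the forward Ricci flow $\frac{d}{dt}g(t)=-\mathrm{Ric}_{g(t)}$ on $M$ with maximal lifetime $T_c$, and let $f(t,\cdot)$ be a solution of $\partial_tf=\frac12\Delta_tf$, $f(0,\cdot)=f_0$. Let $\|f\|_\infty=\sup_M|f_0|$. Then for $T<T_c$, $$T\mapsto\sup_{x\in M}\|\nabla^Tf(T,x)\|_T\ \text{ is non-increasing in time},$$ and, for $0<T<T_c$, $$\sup_{x\in M}\|\nabla^Tf(T,x)\|_T\le\frac{\|f\|_\infty}{\sqrt T}.$$
   Context: $\Delta_t$ and $\mathrm{Ric}_{g(t)}$ are the Laplace-Beltrami operator and Ricci tensor of $g(t)$; $\nabla^Tf(T,\cdot)$ is the gradient of $f(T,\cdot)$ with respect to $g(T)$, and $\|\cdot\|_T$ the norm given by $g(T)$. *)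

(* Defs.v *)
From HB Require Import structures.
From mathcomp Require Import all_boot all_order all_algebra.
From mathcomp Require Import all_classical all_reals all_analysis.
Set Implicit Arguments.
Unset Strict Implicit.
Unset Printing Implicit Defensive.
Import Order.TTheory GRing.Theory Num.Theory.
Import numFieldNormedType.Exports.
Local Open Scope classical_set_scope.
Local Open Scope ring_scope.

(* Directional derivative relative to D: only increments staying in D are
   used, so that it is one-sided at the initial time of [0, T[ x U and is the
   usual derivative at interior points of D. *)
Definition is_derive_within (R : realType) (V : normedModType R) (D : set V)
    (F : V -> R) (v x : V) (l : R) : Prop :=
  (fun h : R => h^-1 * (F (x + h *: v) - F x))
    @ within [set h : R | D (x + h *: v)] 0^' --> l.

Fixpoint Ck_on (R : realType) (V : normedModType R) (k : nat) (D : set V)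
    (F : V -> R) : Prop :=
  {within D, continuous F} /\
  match k with
  | 0 => True
  | k'.+1 => forall v : V, exists G : V -> R,
      (forall x, D x -> is_derive_within D F v x (G x)) /\ Ck_on k' D G
  end.

Definition smooth_on (R : realType) (V : normedModType R) (D : set V)
    (F : V -> R) : Prop := forall k : nat, Ck_on k D F.

Record chart (R : realType) (n : nat) (M : topologicalType) := Chart {
  chart_dom : set M;
  chart_cod : set 'rV[R]_n;
  chart_fun :> M -> 'rV[R]_n;
  chart_inv : 'rV[R]_n -> M;
  chart_dom_open : open chart_dom;
  chart_cod_open : open chart_cod;
  chart_funS : forall p, chart_dom p -> chart_cod (chart_fun p);
  chart_invS : forall y, chart_cod y -> chart_dom (chart_inv y);
  chart_funK : forall p, chart_dom p -> chart_inv (chart_fun p) = p;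
  chart_invK : forall y, chart_cod y -> chart_fun (chart_inv y) = y;
  chart_fun_continuous : {within chart_dom, continuous chart_fun};
  chart_inv_continuous : {within chart_cod, continuous chart_inv}
}.

(* Manifolds without boundary, of dimension n, given by a smooth atlas.  The
   preferred chart [chart_at p] serves to evaluate at p the coordinate
   expression of chart-independent quantities. *)
Record smoothManifold (R : realType) (n : nat) := SmoothManifold {
  carrier :> topologicalType;
  atlas : Type;
  coord : atlas -> chart R n carrier;
  chart_at : carrier -> atlas;
  chart_atP : forall p, chart_dom (coord (chart_at p)) p;
  manifold_hausdorff : hausdorff_space carrier;
  manifold_second_countable : @second_countable carrier;
  transition_smooth : forall (a b : atlas) (j : 'I_n),
    smooth_on
      (chart_cod (coord a) `&`
         [set y | chart_dom (coord b) (chart_inv (coord a) y)])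
      (fun y => coord b (chart_inv (coord a) y) 0 j)
}.

Section LocalGeometry.
Context {R : realType} {n : nat}.
Implicit Types (i j k l m : 'I_n) (y : 'rV[R]_n) (u : 'rV[R]_n -> R).

Definition partial i u y : R := 'D_(delta_mx 0 i) u y.

(* G y is the matrix (g_ij) of the metric at the point of coordinates y. *)
Variable G : 'rV[R]_n -> 'M[R]_n.

(* Gamma^l_ij *)
Definition christoffel l i j y : R :=
  2^-1 * \sum_k invmx (G y) l k *
    (partial i (fun z => G z j k) y + partial j (fun z => G z i k) y
     - partial k (fun z => G z i j) y).

(* R^l_kij, where R(d_i, d_j) d_k = \sum_l R^l_kij d_l and
   R(X, Y) = nabla_X nabla_Y - nabla_Y nabla_X - nabla_[X, Y] *)
Definition riemann l k i j y : R :=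
  partial i (christoffel l j k) y - partial j (christoffel l i k) y
  + \sum_m (christoffel l i m y * christoffel m j k y
            - christoffel l j m y * christoffel m i k y).

(* Ric(Y, Z) is the trace of X |-> R(X, Y) Z. *)
Definition ricci y : 'M[R]_n := \matrix_(j, k) \sum_i riemann i k i j y.

Definition gradient u y : 'rV[R]_n :=
  \row_i \sum_j invmx (G y) i j * partial j u y.

(* the trace of the covariant derivative of X *)
Definition divergence (X : 'rV[R]_n -> 'rV[R]_n) y : R :=
  \sum_i (partial i (fun z => X z 0 i) y
          + \sum_j christoffel i i j y * X y 0 j).

Definition laplacian u y : R := divergence (gradient u) y.

End LocalGeometry.

Definition riemannian_norm (R : realType) (n : nat) (A : 'M[R]_n)
    (v : 'rV[R]_n) : R := Num.sqrt ((v *m A *m v^T) 0 0).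

Section Manifold.
Context {R : realType} {n : nat} (M : smoothManifold R n).
Implicit Types (a b : atlas M) (p : M).

Definition in_coord (T : Type) a (F : M -> T) : 'rV[R]_n -> T :=
  fun y => F (chart_inv (coord a) y).

(* Rows: coordinates of chart a; columns: coordinates of chart b. *)
Definition transition_jacobian a b p : 'M[R]_n :=
  \matrix_(i, j) partial i (in_coord a (fun q => coord b q 0 j)) (coord a p).

(* A 2-tensor field is given by its matrix of components in each chart; only
   the values [g a p] for p in the domain of a are meaningful. *)
Definition tensor_field : Type := atlas M -> M -> 'M[R]_n.

Definition is_riemannian_metric (g : tensor_field) : Prop :=
  [/\ forall a p, chart_dom (coord a) p -> (g a p)^T = g a p,
      forall a p (v : 'rV[R]_n), chart_dom (coord a) p -> v != 0 ->
        0 < (v *m g a p *m v^T) 0 0,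
      forall a b p, chart_dom (coord a) p -> chart_dom (coord b) p ->
        g a p = transition_jacobian a b p *m g b p
                *m (transition_jacobian a b p)^T
    & forall a (i j : 'I_n),
        smooth_on (chart_cod (coord a)) (in_coord a (fun p => g a p i j))].

Definition ricci_tensor (g : tensor_field) : tensor_field :=
  fun a p => ricci (in_coord a (g a)) (coord a p).

Definition laplace_beltrami (g : tensor_field) (u : M -> R) a p : R :=
  laplacian (in_coord a (g a)) (in_coord a u) (coord a p).

Definition gradient_norm (g : tensor_field) (u : M -> R) p : R :=
  let a := chart_at p in
  riemannian_norm (g a p) (gradient (in_coord a (g a)) (in_coord a u) (coord a p)).

Definition sup_gradient_norm (g : tensor_field) (u : M -> R) : \bar R :=
  ereal_sup [set (gradient_norm g u p)%:E | p in [set: M]].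

Definition sup_norm (u : M -> R) : \bar R :=
  ereal_sup [set `|u p|%:E | p in [set: M]].

(* [0, Tc[, where Tc may be +oo *)
Definition lifespan (Tc : \bar R) : set R := [set t | 0 <= t /\ (t%:E < Tc)%E].

Definition ricci_flow (Tc : \bar R) (g : R -> tensor_field) : Prop :=
  [/\ forall t, lifespan Tc t -> is_riemannian_metric (g t),
      forall a (i j : 'I_n),
        @smooth_on R (R * 'rV[R]_n)%type (lifespan Tc `*` chart_cod (coord a))
          (fun z => in_coord a (fun p => g z.1 a p i j) z.2)
    & forall t a p (i j : 'I_n), lifespan Tc t -> chart_dom (coord a) p ->
        is_derive_within (lifespan Tc) (fun s : R => g s a p i j) 1 t
          (- ricci_tensor (g t) a p i j)].

Definition maximal_ricci_flow (Tc : \bar R) (g : R -> tensor_field) : Prop :=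
  [/\ (0 < Tc)%E, ricci_flow Tc g
    & forall (Tc' : \bar R) (g' : R -> tensor_field),
        (Tc < Tc')%E -> ricci_flow Tc' g' ->
        ~ (forall t a p, lifespan Tc t -> chart_dom (coord a) p ->
             g' t a p = g t a p)].

(* Classical solutions: smooth at positive times, continuous up to time 0. *)
Definition heat_solution (Tc : \bar R) (g : R -> tensor_field) (f0 : M -> R)
    (f : R -> M -> R) : Prop :=
  [/\ forall p, f 0 p = f0 p,
      {within lifespan Tc `*` [set: M], continuous (fun z : R * M => f z.1 z.2)},
      forall a,
        @smooth_on R (R * 'rV[R]_n)%type
          ([set t | 0 < t /\ (t%:E < Tc)%E] `*` chart_cod (coord a))
          (fun z => in_coord a (f z.1) z.2)
    & forall t a p, 0 < t -> (t%:E < Tc)%E -> chart_dom (coord a) p ->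
        is_derive t 1 (fun s : R => f s p)
          (2^-1 * laplace_beltrami (g t) (f t) a p)].

(* The spatial differential of f exists and is continuous on [0, Tc[ x M, time
   0 included; this holds for classical solutions with C^1 initial value. *)
Definition spatially_C1_up_to_0 (Tc : \bar R) (f : R -> M -> R) : Prop :=
  forall a (i : 'I_n), exists G : R * 'rV[R]_n -> R,
    {within lifespan Tc `*` chart_cod (coord a), continuous G} /\
    forall t y, lifespan Tc t -> chart_cod (coord a) y ->
      is_derive y (delta_mx 0 i) (in_coord a (f t)) (G (t, y)).

End Manifold.

(* Main.v *)
Require Import Defs.
From HB Require Import structures.
From mathcomp Require Import all_boot all_order all_algebra.
From mathcomp Require Import all_classical all_reals all_analysis.
From mathcomp Require Import ring lra.
Import Order.TTheory GRing.Theory Num.Theory.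
Import numFieldNormedType.Exports.
Local Open Scope classical_set_scope.
Local Open Scope ring_scope.

Set Implicit Arguments.
Unset Strict Implicit.
Unset Printing Implicit Defensive.
(* [coord] is the chart of an index of the atlas, not the coordinates of a
   vector in a basis. *)
Import Defs.

(** Both estimates come from the maximum principle for heat-type operators.
Write |grad f|^2 for the squared norm of the gradient of f(t,.) with respect to
g(t).  The Bochner formula
  (1/2) Delta |grad f|^2
     = |Hess f|^2 + <grad f, grad (Delta f)> + Ric (grad f, grad f)
(lemma [bochner]) and the derivative in time, in which dg/dt = - Ric contributes
exactly Ric (grad f, grad f) (lemma [dt_energy]), give
  (d/dt - Delta/2) |grad f|^2 = - |Hess f|^2 <= 0,
while (d/dt - Delta/2) f^2 = - |grad f|^2.  Hence, for c >= 0 and c <= b,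
  (a + c (t - S)) |grad f|^2 + b f^2
is a subsolution wherever a + c (t - S) >= 0 (lemma [combined_subsolution]),
and its maximum over M does not increase in time.
  - a = 1, c = b = 0: sup |grad f|^2 is non-increasing.
  - a = c = 0, b = 1: sup f^2 is non-increasing.
  - a = 0, c = b = 1, started at a time e > 0:
    (T - e) |grad f|^2 <= sup f(e,.)^2 <= sup f_0^2, and e tends to 0.

The differential identities are proved in one chart, on an open subset of
R * R^n where t and the coordinates play the same role, so that derivatives in
time and in space commute by [derive_comm].  The second-order part needs no
change of charts: at a space-time maximum only the chart around that point
matters.  What has to be global is the scalar |grad f|^2, whose independence
from the chart ([local_energy_change]) follows from the chain rule for first
derivatives; this gives its continuity on [S, T] x M, hence the existence of
the maximum.  The chain rule is proved directly from the continuity of partial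
derivatives ([cvg_dir_sum]), without a regularity assumption in time, so it also
applies at the initial time. *)

(** * Derivatives along lines *)

Section Calculus.
Context {R : realType} {V : normedModType R}.
Implicit Types (D : set V) (F G : V -> R) (x v w : V).

Lemma cvg_line x v : (fun h : R => x + h *: v) @ 0 --> x.
Proof.
rewrite -[X in _ --> X]addr0 -[X in _ + X](scale0r v).
by apply: cvgD; [exact: cvg_cst|apply: cvgZr_tmp; exact: cvg_id].
Qed.

Lemma open_line D x v : open D -> D x -> \forall h \near (0 : R), D (x + h *: v).
Proof. by move=> oD Dx; have /= := @cvg_line x v D (open_nbhs_nbhs (conj oD Dx)). Qed.

(** At a point with a neighbourhood D inside E, the derivative relative to E is
the ordinary directional derivative. *)
Lemma is_derive_withinP D E F v x l : open D -> D `<=` E -> D x ->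
  is_derive_within E F v x l -> is_derive x v F l.
Proof.
move=> oD DE Dx; rewrite /is_derive_within => H.
suff K : (fun h : R => h^-1 *: ((F \o shift x) (h *: v) - F x)) @ 0^' --> l.
  by apply: DeriveDef; [apply/cvg_ex; exists l|exact: cvg_lim K].
have -> : (fun h : R => h^-1 *: ((F \o shift x) (h *: v) - F x)) =
   (fun h : R => h^-1 * (F (x + h *: v) - F x)).
  by apply/funext => h /=; rewrite [h *: v + x]addrC.
move=> A /H HA.
have K : \forall h \near (0:R)^', D (x + h *: v).
  by apply: nbhs_dnbhs; exact: open_line.
change (\forall h \near (0:R)^', A (h^-1 * (F (x + h *: v) - F x))).
move: HA; rewrite /= /nbhs /= /fmap /within /= => HA.
by apply: filterS2 HA K => h H1 /DE H2; exact: H1.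
Qed.

Lemma is_derive_scale F x v (c : R) l :
  is_derive x v F l -> is_derive x (c *: v) F (c * l).
Proof.
move=> [dF Fl].
have [->|c0] := eqVneq c 0.
  by rewrite scale0r mul0r; exact: is_derive0.
suff K : (fun h : R => h^-1 *: ((F \o shift x) (h *: (c *: v)) - F x)) @ 0^' --> c * l.
  by apply: DeriveDef; [apply/cvg_ex; exists (c * l)|exact: cvg_lim K].
pose q (k : R) := k^-1 *: ((F \o shift x) (k *: v) - F x).
have -> : (fun h : R => h^-1 *: ((F \o shift x) (h *: (c *: v)) - F x)) =
  (fun h => c * q (h * c)).
  rewrite /q; apply/funext => h /=; rewrite scalerA.
  have {1}-> : h^-1 = c * (h * c)^-1 by rewrite invfM mulrCA mulfV // mulr1.
  by rewrite /GRing.scale/= -mulrA.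
apply: cvgM; first exact: cvg_cst.
apply: (@cvg_comp _ _ _ (fun h : R => h * c) q _ (0^')); last first.
  by rewrite -Fl; exact: dF.
move=> A; rewrite /dnbhs /within /= => nA.
have : (fun h : R => h * c) @ 0 --> (0 : R).
  by have := @mulrr_continuous R c 0; rewrite /continuous_at mul0r.
move=> /(_ _ nA) nA2.
suff : \forall h \near (0:R), h != 0 -> A (h * c) by [].
apply: filterS (nA2 : \forall h \near (0:R), h * c != 0 -> A (h * c)) => h H h0; apply: H.
by rewrite mulf_eq0 negb_or c0 h0.
Qed.

Lemma is_derive_line F x v (s : R) :
  derivable F (x + s *: v) v ->
  is_derive s 1 (fun s : R => F (x + s *: v)) ('D_v F (x + s *: v)).
Proof.
move=> dF.
pose q (h : R) :=
  h^-1 *: (((fun s : R => F (x + s *: v)) \o shift s) (h *: 1) - F (x + s *: v)).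
suff K : q @ 0^' --> 'D_v F (x + s *: v).
  by apply: DeriveDef; [apply/cvg_ex; eexists; exact: K|exact: cvg_lim K].
have -> : q =
  (fun h : R => h^-1 *: ((F \o shift (x + s *: v)) (h *: v) - F (x + s *: v))).
  by apply/funext => h; rewrite /q /= [_%:A]mulr1 scalerDl addrCA.
exact: dF.
Qed.

(** Mean value theorem on the segment from x to x + v; the intermediate point is
interior to the segment. *)
Lemma line_MVT F x v :
  (forall s : R, 0 <= s <= 1 -> derivable F (x + s *: v) v) ->
  exists2 s : R, 0 < s < 1 & F (x + v) - F x = 'D_v F (x + s *: v).
Proof.
move=> dF.
have [||s s01] := @MVT R (fun s : R => F (x + s *: v)) 
  (fun s => 'D_v F (x + s *: v)) 0 1 ltr01.
- move=> s; rewrite in_itv /= => /andP[s0 s1]; apply: is_derive_line.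
  by apply: dF; rewrite !ltW.
- apply: derivable_within_continuous => s; rewrite in_itv/= => s01.
  have [] := @is_derive_line F x v s; last by [].
  exact: dF.
rewrite scale1r scale0r addr0 subr0 mulr1 => ->.
by exists s => //; move: s01; rewrite in_itv.
Qed.

End Calculus.

(** * Smooth functions on an open set *)

Section Smooth.
Context {R : realType} {V : normedModType R}.
Implicit Types (D : set V) (F G : V -> R) (x v w : V).

(** F is of class C^k on D, in the sense of iterated directional derivatives in
arbitrary directions.  Derivatives are the total functions ['D_v F], whose values
outside D are irrelevant; D is meant to be open. *)
Fixpoint Cn (k : nat) D F : Prop :=
  (forall x, D x -> {for x, continuous F}) /\
  match k with
  | 0 => True
  | k'.+1 => forall v, (forall x, D x -> derivable F x v) /\ Cn k' D ('D_v F)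
  end.

(** F is of class C^k on D for every k. *)
Definition smooth D F : Prop := forall k, Cn k D F.

Variable D : set V.
Hypothesis oD : open D.

Lemma near_open x : D x -> \forall y \near x, D y.
Proof. by move=> Dx; exact: open_nbhs_nbhs. Qed.

Lemma near_eq_in F G x : (forall y, D y -> F y = G y) -> D x ->
  \forall y \near x, F y = G y.
Proof. by move=> FG Dx; apply: filterS (near_open Dx) => y /FG. Qed.

Lemma derive_eq_in F G v x : (forall y, D y -> F y = G y) -> D x ->
  'D_v F x = 'D_v G x.
Proof. by move=> FG Dx; apply: near_eq_derive; exact: near_eq_in. Qed.

Lemma Cn_ext k F G : (forall y, D y -> F y = G y) -> Cn k D F -> Cn k D G.
Proof.
have C F' G' : (forall y, D y -> F' y = G' y) ->
    (forall x, D x -> {for x, continuous F'}) -> forall x, D x -> {for x, continuous G'}.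
  move=> FG cF x Dx; rewrite /prop_for /continuous_at -FG //.
  apply: cvg_trans (cF x Dx); apply: near_eq_cvg.
  exact: near_eq_in.
elim: k F G => [|k IH] F G FG.
  by move=> [cF _]; split=> //; exact: C cF.
move=> [cF H]; split; first exact: C cF.
move=> v; have [dF Ck] := H v; split.
  move=> x Dx; have /derivableP dFx := dF x Dx.
  by have [] := near_eq_is_derive (near_eq_in FG Dx) dFx.
by apply: IH Ck => y Dy; exact: derive_eq_in.
Qed.

Lemma Cn_cst k (c : R) : Cn k D (fun=> c).
Proof.
elim: k c => [|k IH] c.
  by split=> // x _; exact: cst_continuous.
split=> [x _|v]; first exact: cst_continuous.
split=> [x _|]; first exact: derivable_cst.
suff -> : 'D_v (fun=> c) = fun _ : V => 0 :> R by exact: IH.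
by apply/funext => x; exact: derive_cst.
Qed.

Lemma CnW k F : Cn k.+1 D F -> Cn k D F.
Proof.
elim: k F => [|k IH] F [cF H]; first by split.
by split=> // v; have [dF /IH] := H v.
Qed.

Lemma CnD k F G : Cn k D F -> Cn k D G -> Cn k D (fun x => F x + G x).
Proof.
elim: k F G => [|k IH] F G [cF dF] [cG dG].
  by split=> // x Dx; apply: cvgD; [exact: cF|exact: cG].
split=> [x Dx|v]; first by apply: cvgD; [exact: cF|exact: cG].
have [{}dF CF] := dF v; have [{}dG CG] := dG v.
split=> [x Dx|]; first by apply: derivableD; [exact: dF|exact: dG].
apply: Cn_ext (IH _ _ CF CG) => x Dx.
by apply/esym; apply: deriveD; [exact: dF|exact: dG].
Qed.

Lemma CnM k F G : Cn k D F -> Cn k D G -> Cn k D (fun x => F x * G x).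
Proof.
elim: k F G => [|k IH] F G.
  move=> [cF dF] [cG dG].
  by split=> // x Dx; apply: cvgM; [exact: cF|exact: cG].
move=> /[dup] /CnW WF [cF dF] /[dup] /CnW WG [cG dG].
split=> [x Dx|v]; first by apply: cvgM; [exact: cF|exact: cG].
have [{}dF CF] := dF v; have [{}dG CG] := dG v.
split=> [x Dx|]; first by apply: derivableM; [exact: dF|exact: dG].
apply: Cn_ext (CnD (IH _ _ WF CG) (IH _ _ WG CF)) => x Dx.
by apply/esym; apply: deriveM; [exact: dF|exact: dG].
Qed.

Lemma CnV k F : (forall x, D x -> F x != 0) -> Cn k D F ->
  Cn k D (fun x => (F x)^-1).
Proof.
move=> F0; elim: k => [|k IH].
  by move=> [cF _]; split=> // x Dx; apply: cvgV; [exact: F0|exact: cF].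
move=> /[dup] /CnW WF [cF dF].
split=> [x Dx|v]; first by apply: cvgV; [exact: F0|exact: cF].
have [{}dF CF] := dF v.
split=> [x Dx|]; first by apply: derivableV; [exact: F0|exact: dF].
have /= H := CnM (CnM (Cn_cst k (-1)) (CnM (IH WF) (IH WF))) CF.
apply: Cn_ext H => x Dx.
rewrite [RHS](deriveV (F0 x Dx) (dF x Dx)) /GRing.scale /=.
by rewrite expr2 invfM mulN1r.
Qed.

Lemma smooth_ext F G : (forall y, D y -> F y = G y) -> smooth D F -> smooth D G.
Proof. by move=> FG sF k; exact: Cn_ext (sF k). Qed.

Lemma smooth_cst (c : R) : smooth D (fun=> c).
Proof. by move=> k; exact: Cn_cst. Qed.

Lemma smoothD F G : smooth D F -> smooth D G -> smooth D (fun x => F x + G x).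
Proof. by move=> sF sG k; exact: CnD. Qed.

Lemma smoothM F G : smooth D F -> smooth D G -> smooth D (fun x => F x * G x).
Proof. by move=> sF sG k; exact: CnM. Qed.

Lemma smoothV F : (forall x, D x -> F x != 0) -> smooth D F ->
  smooth D (fun x => (F x)^-1).
Proof. by move=> F0 sF k; exact: CnV. Qed.

Lemma smoothN F : smooth D F -> smooth D (fun x => - F x).
Proof.
move=> sF; apply: smooth_ext (smoothM (smooth_cst (-1)) sF) => y _ /=.
by rewrite mulN1r.
Qed.

Lemma smoothB F G : smooth D F -> smooth D G -> smooth D (fun x => F x - G x).
Proof. by move=> sF sG; apply: smoothD => //; exact: smoothN. Qed.

Lemma smooth_sum (I : Type) (r : seq I) (P : pred I) (F : I -> V -> R) :
  (forall i, P i -> smooth D (F i)) -> smooth D (fun x => \sum_(i <- r | P i) F i x).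
Proof.
move=> sF; elim: r => [|i r IH].
  by apply: smooth_ext (smooth_cst 0) => y _; rewrite big_nil.
have [Pi|Pi] := boolP (P i).
  apply: smooth_ext (smoothD (sF i Pi) IH) => y _.
  by rewrite big_cons Pi.
by apply: smooth_ext IH => y _; rewrite big_cons (negbTE Pi).
Qed.

Lemma smooth_prod (I : Type) (r : seq I) (F : I -> V -> R) :
  (forall i, smooth D (F i)) -> smooth D (fun x => \prod_(i <- r) F i x).
Proof.
move=> sF; elim: r => [|i r IH].
  by apply: smooth_ext (smooth_cst 1) => y _; rewrite big_nil.
by apply: smooth_ext (smoothM (sF i) IH) => y _; rewrite big_cons.
Qed.

Lemma smooth_continuous F x : smooth D F -> D x -> {for x, continuous F}.
Proof. by move=> /(_ 0%N) [cF _] /cF. Qed.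

Lemma smooth_derivable F x v : smooth D F -> D x -> derivable F x v.
Proof. by move=> /(_ 1%N) [_ /(_ v) [dF _]] /dF. Qed.

Lemma smooth_derive F v : smooth D F -> smooth D ('D_v F).
Proof. by move=> sF k; have [_ /(_ v) []] := sF k.+1. Qed.

Lemma is_derive_linear F x v :
  (forall (h : R) x v, F (h *: v + x) = h * F v + F x) -> is_derive x v F (F v).
Proof.
move=> lF.
suff K : (fun h : R => h^-1 *: ((F \o shift x) (h *: v) - F x)) @ 0^' --> F v.
  by apply: DeriveDef; [apply/cvg_ex; exists (F v)|exact: cvg_lim K].
apply: cvg_near_cst; near=> h.
rewrite /= lF addrK /GRing.scale /= mulKf //.
by near: h; exact: nbhs_dnbhs_neq.
Unshelve. all: by end_near. Qed.

Lemma smooth_linear F : (forall (h : R) x v, F (h *: v + x) = h * F v + F x) ->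
  continuous F -> smooth D F.
Proof.
move=> lF cF [|k]; first by split=> // x _; exact: cF.
split=> [x _|v]; first exact: cF.
split=> [x _|]; first by have [] := is_derive_linear x v lF.
apply: (@Cn_ext _ (fun=> F v)); last exact: Cn_cst.
by move=> y _; have [_ ->] := is_derive_linear y v lF.
Qed.

Section Rules.
Variables (v x : V).
Hypothesis Dx : D x.

Lemma dirD F G : smooth D F -> smooth D G ->
  'D_v (fun x => F x + G x) x = 'D_v F x + 'D_v G x.
Proof. by move=> sF sG; apply: deriveD; exact: smooth_derivable. Qed.

Lemma dirM F G : smooth D F -> smooth D G ->
  'D_v (fun x => F x * G x) x = 'D_v F x * G x + F x * 'D_v G x.
Proof.
move=> sF sG; rewrite addrC [_ * G x]mulrC.
by apply: deriveM; exact: smooth_derivable.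
Qed.

Lemma dirB F G : smooth D F -> smooth D G ->
  'D_v (fun x => F x - G x) x = 'D_v F x - 'D_v G x.
Proof. by move=> sF sG; apply: deriveB; exact: smooth_derivable. Qed.

Lemma dirZ (c : R) F : smooth D F -> 'D_v (fun x => c * F x) x = c * 'D_v F x.
Proof.
move=> sF; rewrite dirM //; last exact: smooth_cst.
by rewrite [X in X * _]derive_cst mul0r add0r.
Qed.

Lemma dir_sum (I : Type) (r : seq I) (P : pred I) (F : I -> V -> R) :
  (forall i, P i -> smooth D (F i)) ->
  'D_v (fun x => \sum_(i <- r | P i) F i x) x = \sum_(i <- r | P i) 'D_v (F i) x.
Proof.
move=> sF; elim: r => [|i r IH].
  rewrite big_nil (_ : (fun _ => _) = cst 0) ?derive_cst //.
  by apply/funext => y; rewrite big_nil.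
rewrite big_cons; have [Pi|Pi] := boolP (P i).
  rewrite -IH -dirD; [|exact: sF|exact: smooth_sum].
  by congr ('D_v _ x); apply/funext => y; rewrite big_cons Pi.
rewrite -IH; congr ('D_v _ x); apply/funext => y.
by rewrite big_cons (negbTE Pi).
Qed.

End Rules.
End Smooth.

(** On an open set, one-sided derivatives relative to a larger set are ordinary
ones, so that [smooth_on] implies [smooth]. *)
Lemma smooth_on_smooth (R : realType) (V : normedModType R) (E D : set V)
    (F : V -> R) : open D -> D `<=` E -> smooth_on E F -> smooth D F.
Proof.
move=> oD DE sF k; have {sF} := sF k.
have cFD (F' : V -> R) : {within E, continuous F'} -> forall x, D x -> {for x, continuous F'}.
  move=> cF x Dx; have := (subspace_continuousP _ _).1 cF x (DE _ Dx).
  rewrite within_interior //; apply: (interiorS DE).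
  by rewrite /interior; exact: open_nbhs_nbhs.
elim: k F => [|k IH] F /= [cF H].
  split=> // x Dx; exact: cFD.
split; first exact: cFD.
move=> v; have [G [dG CG]] := H v.
have dF x : D x -> is_derive x v F (G x).
  by move=> Dx; apply: (is_derive_withinP oD DE) => //; apply: dG; exact: DE.
split=> [x /dF[]//|].
by apply: (Cn_ext oD) (IH _ CG) => x /dF[].
Qed.

(** * A chain rule for continuous directional derivatives *)

Section Chain.
Context {R : realType} {V : normedModType R}.
Implicit Types (D : set V) (F G : V -> R) (x v w : V).

(** Differentiation along a moving base point b(h) and a moving direction
c(h) v. *)
Lemma cvg_dir_step D F x v (l : R) (b : R -> V) (c : R -> R) :
  open D -> D x -> (forall y, D y -> derivable F y v) ->
  {for x, continuous ('D_v F)} ->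
  b h @[h --> 0^'] --> x -> c h @[h --> 0^'] --> l ->
  h^-1 * (F (b h + h *: (c h *: v)) - F (b h)) @[h --> (0:R)^'] --> l * 'D_v F x.
Proof.
move=> oD Dx dF cF bx cl.
have hc0 : (h * c h) @[h --> (0:R)^'] --> (0:R).
  have : (fun h : R => h) @ 0^' --> (0:R) by exact: nbhs_dnbhs.
  by move=> /cvgM /(_ cl); rewrite mul0r.
(* s(h) is the parameter of a mean value point, when there is one; the value 0
   serves for the other h, so that s(h) always lies in [0, 1] *)
pose mean (h s : R) := F (b h + h *: (c h *: v)) - F (b h) =
  h * c h * 'D_v F (b h + (s * (h * c h)) *: v).
pose P (h s : R) := 0 <= s <= 1 /\
  ((exists s', 0 <= s' <= 1 /\ mean h s') -> mean h s).
have exP h : exists s, P h s.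
  have [[s' [s01 Hs]]|N] := pselect (exists s', 0 <= s' <= 1 /\ mean h s').
    by exists s'.
  by exists 0; split; rewrite ?lexx ?ler01.
have [s Hs] := choice exP.
have xi : b h + (s h * (h * c h)) *: v @[h --> (0:R)^'] --> x.
  rewrite -[X in _ --> X]addr0 -[X in _ + X](scale0r v).
  apply: cvgD => //; apply: cvgZr_tmp.
  apply/cvgr0Pnorm_lt => e e0.
  have /cvgr0Pnorm_lt/(_ e e0) := hc0; apply: filterS => h.
  apply: le_lt_trans; rewrite normrM -[leRHS]mul1r ler_wpM2r //.
  by have [/andP[s0 s1] _] := Hs h; rewrite ger0_norm.
have : c h * 'D_v F (b h + (s h * (h * c h)) *: v) @[h --> (0:R)^'] --> l * 'D_v F x.
  by apply: cvgM => //; exact: (cvg_comp _ _ xi cF).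
apply: cvg_trans; apply: near_eq_cvg.
have /nbhs_ballP[e /= e0 De] : nbhs x D by exact: open_nbhs_nbhs.
have e20 : 0 < e / 2 by rewrite divr_gt0.
have v10 : 0 < `|v| + 1 by rewrite ltr_wpDl.
near=> h.
have h0 : h != 0 by near: h; exact: nbhs_dnbhs_neq.
have b2 : `|x - b h| < e / 2 by near: h; move/cvgr_dist_lt: bx; exact.
have hc2 : `|h * c h| < e / 2 / (`|v| + 1).
  by near: h; move/cvgr0Pnorm_lt: hc0; apply; rewrite divr_gt0.
have [_ ->] := Hs h; first by rewrite -!mulrA mulKf.
have inD r : 0 <= r <= 1 -> D (b h + r *: ((h * c h) *: v)).
  move=> r01; apply: De; rewrite -ball_normE /ball_ /= opprD addrA.
  apply: le_lt_trans (ler_normB _ _) _; rewrite [e]splitr ltrD //.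
  rewrite !normrZ; case/andP: r01 => r0 r1; rewrite ger0_norm //.
  apply: (@le_lt_trans _ _ (`|h * c h| * `|v|)).
    by rewrite -[leRHS]mul1r normrM ler_wpM2r // !mulr_ge0.
  apply: (@le_lt_trans _ _ (`|h * c h| * (`|v| + 1))).
    by rewrite ler_wpM2l // lerDl.
  by rewrite -ltr_pdivlMr.
have [r /inD Dr|r /andP[/ltW r0 /ltW r1] E] := @line_MVT R V F (b h) ((h * c h) *: v).
  by have [] := is_derive_scale (h * c h) (derivableP (dF _ Dr)).
have r01 : 0 <= r <= 1 by rewrite r0.
exists r; split => //; rewrite /mean scalerA E !scalerA.
suff Dr : D (b h + (r * (h * c h)) *: v).
  by have [_ ->] := is_derive_scale (h * c h) (derivableP (dF _ Dr)).
rewrite -scalerA; exact: inD.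
Unshelve. all: by end_near. Qed.

(** Chain rule along the curve x + h \sum_i c_i(h) v_i, where c_i(h) tends to
l_i.  Only the directional derivatives along the v_i are used, and only their
continuity at x: the increments along the v_i are taken one after the other. *)
Lemma cvg_dir_sum (I : Type) (s : seq I) D F x (v : I -> V)
    (c : I -> R -> R) (l : I -> R) :
  open D -> D x -> (forall i y, D y -> derivable F y (v i)) ->
  (forall i, {for x, continuous ('D_(v i) F)}) ->
  (forall i, c i h @[h --> 0^'] --> l i) ->
  h^-1 * (F (x + h *: \sum_(i <- s) c i h *: v i) - F x) @[h --> (0:R)^'] -->
    \sum_(i <- s) l i * 'D_(v i) F x.
Proof.
move=> oD Dx dF cF cl; elim: s => [|i s IH].
  rewrite big_nil; apply: cvg_near_cst; near=> h.
  by rewrite big_nil scaler0 addr0 subrr mulr0.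
have bx : x + h *: \sum_(i <- s) c i h *: v i @[h --> (0:R)^'] --> x.
  rewrite -[X in _ --> X]addr0 -[X in _ + X](scale0r (\sum_(i <- s) l i *: v i)).
  apply: cvgD; first exact: cvg_cst.
  apply: cvgZ; first exact: nbhs_dnbhs.
  elim: s {IH} => [|j s IHs].
    by rewrite big_nil; apply: cvg_near_cst; near=> h; rewrite big_nil.
  under eq_fun do rewrite big_cons.
  by rewrite big_cons; apply: cvgD => //; apply: cvgZr_tmp.
rewrite big_cons.
have S := cvg_dir_step oD Dx (dF i) (cF i) bx (cl i).
pose f1 (h : R) := h^-1 * (F (x + h *: \sum_(i <- s) c i h *: v i + h *: (c i h *: v i)) -
                   F (x + h *: \sum_(i <- s) c i h *: v i)).
pose f2 (h : R) := h^-1 * (F (x + h *: \sum_(i <- s) c i h *: v i) - F x).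
have H : f1 h + f2 h @[h --> (0:R)^'] -->
    l i * 'D_(v i) F x + \sum_(i <- s) l i * 'D_(v i) F x.
  by apply: cvgD.
apply: cvg_trans H; apply: near_eq_cvg; near=> h.
rewrite /f1 /f2 -mulrDr subrKA; congr (_ * (F _ - _)).
by rewrite big_cons scalerDr -addrA; congr (_ + _); rewrite addrC.
Unshelve. all: by end_near. Qed.

End Chain.

(** * Second derivatives *)

(** A point cannot be closer to both a and b than half of their distance. *)
Lemma half_dist_absurd (R : realFieldType) (a b c : R) :
  `|a - c| < `|a - b| / 2 -> `|b - c| < `|a - b| / 2 -> False.
Proof. by move=> H1 H2; have := ler_distD c a b; rewrite (distrC c b); lra. Qed.

Section Second.
Context {R : realType} {V : normedModType R}.
Implicit Types (D : set V) (F G : V -> R) (x v w : V).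

Lemma is_derive_translate F x v w :
  derivable F (x + w) v -> is_derive x v (fun y => F (y + w)) ('D_v F (x + w)).
Proof.
move=> dF.
have E : (fun h : R => h^-1 *: (((fun y => F (y + w)) \o shift x) (h *: v) - F (x + w))) =
  (fun h : R => h^-1 *: ((F \o shift (x + w)) (h *: v) - F (x + w))).
  by apply/funext => h /=; rewrite addrA.
by apply: DeriveDef; rewrite /derivable /derive E.
Qed.

(** The second difference of F is a mixed second derivative at some intermediate
point. *)
Lemma second_difference D F x v w : open D -> smooth D F ->
  (forall s r : R, 0 <= s <= 1 -> 0 <= r <= 1 -> D (x + s *: v + r *: w)) ->
  exists s r : R, [/\ 0 <= s <= 1, 0 <= r <= 1 &
    F (x + v + w) - F (x + v) - F (x + w) + F x = 'D_w ('D_v F) (x + s *: v + r *: w)].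
Proof.
move=> oD sF inD.
have inD1 s : 0 <= s <= 1 -> D (x + s *: v + w).
  by move=> s01; rewrite -[w]scale1r; apply: inD; rewrite ?lexx ?ler01.
have inD0 s : 0 <= s <= 1 -> D (x + s *: v).
  by move=> s01; rewrite -[_ + _]addr0 -(scale0r w); apply: inD; rewrite ?lexx ?ler01.
have dG s : 0 <= s <= 1 -> is_derive (x + s *: v) v (fun y => F (y + w) - F y)
     ('D_v F (x + s *: v + w) - 'D_v F (x + s *: v)).
  move=> s01; apply: (@is_deriveB _ _ _ (fun y => F (y + w)) F).
    by apply: is_derive_translate; apply: smooth_derivable sF _; exact: inD1.
  by apply: derivableP; apply: smooth_derivable sF _; exact: inD0.
have [s /dG[]//|s /andP[/ltW s0 /ltW s1]] := @line_MVT R V (fun y => F (y + w) - F y) x v.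
have s01 : 0 <= s <= 1 by rewrite s0.
have [_ ->] := dG s s01.
have sdF := smooth_derive v sF.
have [r r01|r /andP[/ltW r0 /ltW r1] ->] := @line_MVT R V ('D_v F) (x + s *: v) w.
  by apply: smooth_derivable sdF _; exact: inD.
have r01 : 0 <= r <= 1 by rewrite r0.
move=> E; exists s, r; split => //; rewrite -E; ring.
Qed.

(** Symmetry of second derivatives. *)
Lemma derive_comm D F x v w : open D -> smooth D F -> D x ->
  'D_w ('D_v F) x = 'D_v ('D_w F) x.
Proof.
move=> oD sF Dx.
set a := 'D_w _ _; set b := 'D_v _ _.
apply/eqP; rewrite -subr_eq0; apply/negPn/negP => ab0.
have e0 : 0 < `|a - b| / 2 by rewrite divr_gt0 // normr_gt0.
set e := `|a - b| / 2 in e0.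
have cvw : 'D_w ('D_v F) y @[y --> x] --> a.
  exact: (smooth_continuous (smooth_derive w (smooth_derive v sF)) Dx).
have cwv : 'D_v ('D_w F) y @[y --> x] --> b.
  exact: (smooth_continuous (smooth_derive v (smooth_derive w sF)) Dx).
have /cvgr_dist_lt/(_ e e0) N1 := cvw.
have /cvgr_dist_lt/(_ e e0) N2 := cwv.
have : \forall y \near x, [/\ D y, `|a - 'D_w ('D_v F) y| < e & `|b - 'D_v ('D_w F) y| < e].
  exact: (filterS3 _ (fun y H1 H2 H3 => And3 H1 H2 H3) (near_open oD Dx) N1 N2).
move=> /nbhs_ballP[d /= d0 Hd].
pose h := d / 2 / (`|v| + `|w| + 1).
have n0 : 0 < `|v| + `|w| + 1 by rewrite ltr_wpDl // addr_ge0.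
have h0 : 0 < h by rewrite !divr_gt0.
have Hb s r : 0 <= s <= 1 -> 0 <= r <= 1 -> ball x d (x + s *: (h *: v) + r *: (h *: w)).
  move=> /andP[s0 s1] /andP[r0 r1].
  rewrite -ball_normE /ball_ /= -addrA opprD addrA subrr add0r normrN.
  apply: le_lt_trans (ler_normD _ _) _.
  rewrite !normrZ !ger0_norm //; try exact: ltW.
  apply: (@le_lt_trans _ _ (h * (`|v| + `|w| + 1))).
    have V0 := normr_ge0 v; have W0 := normr_ge0 w.
    have H1 : s * (h * `|v|) <= h * `|v| by rewrite ler_piMl // mulr_ge0 // ltW.
    have H2 : r * (h * `|w|) <= h * `|w| by rewrite ler_piMl // mulr_ge0 // ltW.
    by rewrite !mulrDr mulr1; apply: ler_wpDr; [exact: ltW|exact: lerD].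
  by rewrite /h mulfVK ?gt_eqF //; lra.
have inD s r : 0 <= s <= 1 -> 0 <= r <= 1 -> D (x + s *: (h *: v) + r *: (h *: w)).
  by move=> s01 r01; have [] := Hd _ (Hb _ _ s01 r01).
have inD' s r : 0 <= s <= 1 -> 0 <= r <= 1 -> D (x + s *: (h *: w) + r *: (h *: v)).
  by move=> s01 r01; rewrite addrAC; apply: inD.
have dscale v1 v2 y : D y -> 'D_(h *: v2) ('D_(h *: v1) F) y = h * (h * 'D_v2 ('D_v1 F) y).
  move=> Dy.
  have -> : 'D_(h *: v2) ('D_(h *: v1) F) y = 'D_(h *: v2) (fun z => h * 'D_v1 F z) y.
    apply: derive_eq_in Dy => // z Dz.
    by have [_ ->] := is_derive_scale h (derivableP (smooth_derivable (v:=v1) sF Dz)).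
  rewrite (dirZ _ Dy _ (smooth_derive v1 sF)).
  by have [_ ->] := is_derive_scale h (derivableP (smooth_derivable (v:=v2) (smooth_derive v1 sF) Dy)).
(* both mixed derivatives are values of the same second difference *)
have [s [r [s01 r01]]] := second_difference oD sF inD.
have [s' [r' [s01' r01']]] := second_difference oD sF inD'.
rewrite dscale; last exact: inD'.
rewrite dscale; last exact: inD.
have [_ _ H2] := Hd _ (Hb _ _ r01' s01').
have [_ H1 _] := Hd _ (Hb _ _ s01 r01).
rewrite [x + s' *: _ + _]addrAC.
move: H1 H2; set A1 := 'D_w _ _; set B1 := 'D_v _ _ => H1 H2 EB EA.
have AB : A1 = B1.
  apply: (mulfI (lt0r_neq0 h0)); apply: (mulfI (lt0r_neq0 h0)).
  apply: (etrans (esym EA)); apply: (etrans _ EB).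
  by rewrite [x + h *: w + _]addrAC; congr (_ + _); exact: addrAC.
move: H1 H2; rewrite AB => H1 H2.
exact: (half_dist_absurd H1 H2).
Qed.

(** A derivative is bounded below by d as soon as the graph lies below the line
of slope d on the left of the point.  Only one side is used: a maximum over
[S, T] may be reached at the time T. *)
Lemma derive_left_ge F x v l (d : R) : is_derive x v F l ->
  (\forall h \near (0 : R), h < 0 -> F (x + h *: v) <= F x + d * h) -> d <= l.
Proof.
move=> [dF Fl] H; rewrite leNgt; apply/negP => ld.
have K : (fun h : R => h^-1 *: ((F \o shift x) (h *: v) - F x)) @ 0^' --> l.
  by rewrite -Fl; exact: dF.
have K2 : \forall h \near (0 : R), h != 0 -> h^-1 *: (F (h *: v + x) - F x) < d.
  exact: (cvgr_lt _ K _ ld).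
have : \forall h \near (0 : R), h < 0 -> False.
  apply: filterS2 H K2 => h H K2 h0.
  have {}K2 := K2 (negbT (lt_eqF h0)); have {}H := H h0.
  move: K2; rewrite /GRing.scale /= ltNge => /negP; apply.
  have hi : h^-1 < 0 by rewrite invr_lt0.
  rewrite mulrC -ler_ndivlMr // invrK [h *: v + x]addrC; lra.
move=> /nbhs_ballP[e /= e0 /(_ (- (e / 2)))]; apply.
  by rewrite -ball_normE /ball_ /= opprK add0r ger0_norm; lra.
by lra.
Qed.

(** First and second derivative tests at a maximum along a line. *)
Lemma derive_max D F x v : open D -> smooth D F -> D x ->
  (\forall h \near (0 : R), F (x + h *: v) <= F x) ->
  'D_v F x = 0 /\ 'D_v ('D_v F) x <= 0.
Proof.
move=> oD sF Dx H.
have le0 w l : (\forall h \near (0 : R), F (x + h *: w) <= F x) -> is_derive x w F l -> 0 <= l.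
  move=> Hw dw; apply: derive_left_ge dw _.
  by apply: filterS Hw => h; rewrite mul0r addr0.
have dFx := derivableP (smooth_derivable (v:=v) sF Dx).
have D0 : 'D_v F x = 0.
  apply/eqP; rewrite eq_le; apply/andP; split; last exact: le0 H dFx.
  rewrite -oppr_ge0 -mulN1r; apply: (le0 (-1 *: v)); last exact: is_derive_scale.
  have /= := (@oppr_continuous R R 0); rewrite /continuous_at oppr0 => /(_ _ H) H'.
  have {}H' : \forall h \near (0:R), F (x + (- h) *: v) <= F x by exact: H'.
  suff : \forall h \near (0:R), F (x + h *: (-1 *: v)) <= F x by [].
  by apply: filterS H' => h /=; rewrite scalerA mulrN1.
split=> //; rewrite leNgt; apply/negP => c0.
have [dFF _] := derivableP (smooth_derivable (v:=v) (smooth_derive v sF) Dx).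
(* a positive second derivative would make F increase to the right of x *)
have K2 : \forall h \near (0 : R), h != 0 -> 0 < h^-1 *: ('D_v F (h *: v + x) - 'D_v F x).
  exact: (cvgr_gt _ dFF _ c0).
have : \forall h \near (0 : R), [/\ F (x + h *: v) <= F x, D (x + h *: v) &
    h != 0 -> 0 < h^-1 *: ('D_v F (h *: v + x) - 'D_v F x)].
  exact: (filterS3 _ (fun y H1 H2 H3 => And3 H1 H2 H3) H (open_line v oD Dx) K2).
move=> /nbhs_ballP[e /= e0 He].
have Hs s : 0 <= s <= 1 -> ball 0 e (s * (e / 2)).
  move=> /andP[s0 s1]; rewrite -ball_normE /ball_ /= add0r normrN ger0_norm.
    by apply: (@le_lt_trans _ _ (1 * (e / 2))); [rewrite ler_wpM2r //; lra|lra].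
  by rewrite mulr_ge0 //; lra.
have Ds s : 0 <= s <= 1 -> D (x + s *: ((e / 2) *: v)).
  by move=> /Hs /He; rewrite scalerA => -[].
have dF2 s : 0 <= s <= 1 ->
  is_derive (x + s *: ((e / 2) *: v)) ((e / 2) *: v)
    F (e / 2 * 'D_v F (x + s *: ((e / 2) *: v))).
  move=> /Ds Dy; apply: is_derive_scale; apply: derivableP; exact: smooth_derivable sF Dy.
have [s /dF2[]//|s /andP[s0 s1] E] := @line_MVT R V F x ((e / 2) *: v).
have s01 : 0 <= s <= 1 by rewrite !ltW.
have [H1 _ _] := He _ (Hs 1 ltac:(by rewrite lexx ler01)).
have [_ _ H2] := He _ (Hs s s01).
have p0 : 0 < s * (e / 2) by rewrite mulr_gt0 //; lra.
have {}H2 := H2 (lt0r_neq0 p0).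
have [_ E2] := dF2 s s01; rewrite E2 in E.
rewrite D0 subr0 [_ + x]addrC /GRing.scale /= pmulr_rgt0 ?invr_gt0 // in H2.
rewrite scalerA in E.
rewrite mul1r -subr_le0 E pmulr_rle0 in H1; last lra.
by have := lt_le_trans H2 H1; rewrite ltxx.
Qed.

End Second.

(** * Positive definite matrices *)

(** Symmetric positive definite matrices; quadratic forms act on row vectors. *)
Definition posdef (R : realType) (n : nat) (A : 'M[R]_n) : Prop :=
  A^T = A /\ forall v : 'rV[R]_n, v != 0 -> 0 < (v *m A *m v^T) 0 0.

Section LinAlg.
Context {R : realType}.

Lemma posdef_unit n (A : 'M[R]_n) : posdef A -> A \in unitmx.
Proof.
move=> [_ pA]; rewrite -row_free_unit -kermx_eq0.
apply/negPn/negP => /rowV0Pn[v /sub_kermxP vA v0].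
by have := pA v v0; rewrite vA mul0mx mxE ltxx.
Qed.

Lemma posdef_inv n (A : 'M[R]_n) : posdef A -> posdef (invmx A).
Proof.
move=> pA; have uA := posdef_unit pA; have [sA {}pA] := pA; split.
  by rewrite trmx_inv sA.
move=> v v0.
have w0 : v *m invmx A != 0.
  by apply: contra v0 => /eqP E; rewrite -(mulmxKV uA v) E mul0mx.
have := pA _ w0; rewrite mulmxKV // trmx_mul trmx_inv sA.
by rewrite mulmxA.
Qed.

(** Cholesky factorisation, by induction on the size with a Schur complement. *)
Lemma posdef_factor n (A : 'M[R]_n) : posdef A -> exists B : 'M[R]_n, A = B^T *m B.
Proof.
elim: n A => [|n IH] A [sA pA].
  by exists 0; apply/matrixP => -[].
rewrite -[n.+1]/(1 + n)%N in A sA pA *.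
pose a := ulsubmx A; pose b := ursubmx A; pose C := drsubmx A.
have EA : A = block_mx a b b^T C.
  by rewrite -[LHS]submxK; congr block_mx; rewrite /b trmx_ursub sA.
have a0 : 0 < a 0 0.
  have e0 : row_mx (1%:M : 'M[R]_1) (0 : 'rV[R]_n) != 0.
    by apply/eqP => /matrixP /(_ 0 (lshift _ 0)); rewrite row_mxEl !mxE /= => /eqP; rewrite oner_eq0.
  have := pA _ e0; rewrite EA mul_row_block tr_row_mx mul_row_col.
  by rewrite !mul1mx !mul0mx !trmx1 !trmx0 !mulmx0 !addr0 mulmx1.
pose s := Num.sqrt (a 0 0).
have s0 : 0 < s by rewrite sqrtr_gt0.
have s2 : s * s = a 0 0 by rewrite -expr2 sqr_sqrtr // ltW.
have aE : a = (a 0 0)%:M by rewrite -mx11_scalar.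
pose C' := C - (a 0 0)^-1 *: (b^T *m b).
have [B' EB'] : exists B' : 'M[R]_n, C' = B'^T *m B'.
  apply: IH; split.
    rewrite /C' linearB linearZ /= trmx_mul trmxK; congr (_ - _).
    by rewrite /C trmx_drsub sA.
  move=> v v0.
  (* the minimum of the quadratic form over the first coordinate is its Schur
     complement, reached at c *)
  pose c := - (a 0 0)^-1 *: (v *m b^T).
  have w0 : row_mx c v != 0 by rewrite row_mx_eq0 negb_and v0 orbT.
  have := pA _ w0; rewrite EA mul_row_block tr_row_mx mul_row_col.
  suff -> : (c *m a + v *m b^T) *m c^T + (c *m b + v *m C) *m v^T = v *m C' *m v^T by [].
  have -> : c *m a + v *m b^T = 0.
    by rewrite /c -scalemxAl {2}aE mul_mx_scalar scalerA mulNr mulVf ?gt_eqF // scaleN1r addNr.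
  rewrite mul0mx add0r; congr (_ *m _).
  by rewrite /c /C' mulmxBr addrC -scalemxAr scaleNr mulNmx -scalemxAl mulmxA.
exists (block_mx s%:M (s^-1 *: b) 0 B').
rewrite tr_block_mx mulmx_block !trmx0 !mul0mx !mulmx0 !addr0 tr_scalar_mx.
rewrite -scalar_mxM s2 -aE mul_scalar_mx scalerA mulfV ?gt_eqF // scale1r.
rewrite mul_mx_scalar linearZ /= scalerA mulfV ?gt_eqF // scale1r.
rewrite -EB' /C' -scalemxAl -scalemxAr scalerA -invfM s2 addrC subrK.
exact: EA.
Qed.

(** The trace of A N is non-positive if A is positive definite and the quadratic
form of N is non-positive. *)
Lemma posdef_sum_le0 n (A N : 'M[R]_n) : posdef A ->
  (forall v : 'rV[R]_n, \sum_i \sum_j v 0 i * v 0 j * N i j <= 0) ->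
  \sum_i \sum_j A i j * N i j <= 0.
Proof.
move=> /posdef_factor[B EB] HN.
suff -> : \sum_i \sum_j A i j * N i j = \sum_k \sum_i \sum_j row k B 0 i * row k B 0 j * N i j.
  by apply: sumr_le0 => k _; exact: HN.
rewrite [RHS]exchange_big; apply: eq_bigr => i _.
rewrite [RHS]exchange_big; apply: eq_bigr => j _.
rewrite EB mxE big_distrl; apply: eq_bigr => k _ /=.
by rewrite !mxE.
Qed.

(** With A = B^T B, the trace of A S A S is the squared Frobenius norm of the
symmetric matrix B S B^T. *)
Lemma mxtrace_posdef_sqr n (A S : 'M[R]_n) : posdef A -> S^T = S ->
  0 <= \tr (A *m S *m (A *m S)).
Proof.
move=> /posdef_factor[B ->] sS.
have -> : B^T *m B *m S *m (B^T *m B *m S) = B^T *m (B *m S *m B^T *m B *m S).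
  by rewrite !mulmxA.
rewrite mxtrace_mulC.
have -> : B *m S *m B^T *m B *m S *m B^T = (B *m S *m B^T) *m (B *m S *m B^T)^T.
  by rewrite !trmx_mul trmxK sS !mulmxA.
move: (B *m S *m B^T) => X.
rewrite /mxtrace; apply: sumr_ge0 => i _; rewrite mxE; apply: sumr_ge0 => j _.
by rewrite [X^T _ _]mxE -expr2 sqr_ge0.
Qed.

Section SmoothMx.
Context {V : normedModType R} (D : set V) (oD : open D).

Lemma smooth_det n (G : V -> 'M[R]_n) :
  (forall i j, smooth D (fun z => G z i j)) -> smooth D (fun z => \det (G z)).
Proof.
move=> sG; rewrite /determinant; apply: smooth_sum => // s _.
apply: smoothM => //; first exact: smooth_cst.
exact: smooth_prod.
Qed.

Lemma smooth_invmx n (G : V -> 'M[R]_n) :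
  (forall i j, smooth D (fun z => G z i j)) ->
  (forall z, D z -> G z \in unitmx) ->
  forall i j, smooth D (fun z => invmx (G z) i j).
Proof.
move=> sG uG i j.
have := @smoothM R V D oD (fun z => (\det (G z))^-1) (fun z => (\adj (G z)) i j).
move=> H; apply: smooth_ext (H _ _) => //.
- by move=> z Dz; rewrite /invmx uG // !mxE.
- apply: smoothV => //; last exact: smooth_det.
  by move=> z /uG; rewrite unitmxE unitfE.
- under eq_fun do rewrite mxE /cofactor.
  apply: smoothM => //; first exact: smooth_cst.
  apply: smooth_det => k l.
  by under eq_fun do rewrite !mxE; exact: sG.
Qed.

End SmoothMx.
End LinAlg.

(** * The Levi-Civita connection in space-time coordinates *)

Section Bochner.
Context {R : realType} {n : nat}.
Let V : normedModType R := (R * 'rV[R]_n)%type.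
Variables (D : set V) (oD : open D) (G : V -> 'M[R]_n).
Hypothesis sG : forall i j, smooth D (fun z => G z i j).
Hypothesis pG : forall z, D z -> posdef (G z).
Implicit Types (i j k l m : 'I_n) (z : V) (u f : V -> R).

(** Points are pairs (t, y) of a time and of space coordinates; [axis i] is the
i-th space direction. *)
Definition axis i : V := (0, delta_mx 0 i).
Local Notation d i u := ('D_(axis i) u).

(** The Christoffel symbol Gamma^l_ij of the metric G(t,.). *)
Definition chr l i j z : R :=
  2^-1 * \sum_k invmx (G z) l k *
    (d i (fun z => G z j k) z + d j (fun z => G z i k) z
     - d k (fun z => G z i j) z).

(** The l-th component of the spatial gradient of u. *)
Definition grad u l z : R := \sum_m invmx (G z) l m * d m u z.

(** The Hessian of u as an endomorphism: the k-th component of the covariant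
derivative of grad u along [axis l]. *)
Definition hess u k l z : R := d l (grad u k) z + \sum_m chr k l m z * grad u m z.

(** The Laplacian of u, i.e. the trace of its Hessian. *)
Definition lap u z : R := \sum_k hess u k k z.

(** The Ricci tensor of G(t,.). *)
Definition ric j k z : R :=
  \sum_i (d i (chr i j k) z - d j (chr i i k) z
    + \sum_m (chr i i m z * chr m j k z - chr i j m z * chr m i k z)).

(** |grad u|^2, as the pairing of grad u with du. *)
Definition energy u z : R := \sum_l grad u l z * d l u z.

Lemma smooth_inv i j : smooth D (fun z => invmx (G z) i j).
Proof. by apply: smooth_invmx => // z /pG /posdef_unit. Qed.

Lemma smooth_chr l i j : smooth D (chr l i j).
Proof.
apply: smoothM => //; first exact: smooth_cst.
apply: smooth_sum => // k _; apply: smoothM => //; first exact: smooth_inv.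
by apply: smoothB => //; [apply: smoothD => //|]; exact: smooth_derive.
Qed.

Lemma smooth_grad u l : smooth D u -> smooth D (grad u l).
Proof.
move=> su; apply: smooth_sum => // k _; apply: smoothM => //.
  exact: smooth_inv.
exact: smooth_derive.
Qed.

Lemma smooth_hess u k l : smooth D u -> smooth D (hess u k l).
Proof.
move=> su; apply: smoothD => //; first by apply: smooth_derive; exact: smooth_grad.
apply: smooth_sum => // m _; apply: smoothM => //; first exact: smooth_chr.
exact: smooth_grad.
Qed.

Lemma smooth_lap u : smooth D u -> smooth D (lap u).
Proof. by move=> su; apply: smooth_sum => // k _; exact: smooth_hess. Qed.

Lemma smooth_energy u : smooth D u -> smooth D (energy u).
Proof.
move=> su; apply: smooth_sum => // k _; apply: smoothM => //.
  exact: smooth_grad.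
exact: smooth_derive.
Qed.

Lemma G_sym i j z : D z -> G z i j = G z j i.
Proof. by move=> /pG[sGz _]; rewrite -[in LHS]sGz mxE. Qed.

Lemma dG_sym v i j z : D z -> 'D_v (fun z => G z i j) z = 'D_v (fun z => G z j i) z.
Proof. by move=> Dz; apply: derive_eq_in Dz => // y Dy; exact: G_sym. Qed.

Lemma invG_mul i j z : D z -> \sum_k invmx (G z) i k * G z k j = (i == j)%:R.
Proof.
move=> /pG /posdef_unit uG; have := mulVmx uG => /matrixP /(_ i j).
by rewrite !mxE.
Qed.

Lemma mul_invG i j z : D z -> \sum_k G z i k * invmx (G z) k j = (i == j)%:R.
Proof.
move=> /pG /posdef_unit uG; have := mulmxV uG => /matrixP /(_ i j).
by rewrite !mxE.
Qed.

Lemma sum_delta (a : 'I_n -> R) i : \sum_k (i == k)%:R * a k = a i.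
Proof.
rewrite (bigD1 i) //= eqxx mul1r big1 ?addr0 // => k /negbTE.
by rewrite eq_sym => ->; rewrite mul0r.
Qed.

Lemma lower_raise (a : 'I_n -> R) i z : D z ->
  \sum_l G z i l * (\sum_m invmx (G z) l m * a m) = a i.
Proof.
move=> Dz; under eq_bigr do rewrite mulr_sumr.
rewrite exchange_big /= -[RHS](sum_delta a); apply: eq_bigr => m _.
by rewrite -(mul_invG _ _ Dz) mulr_suml; apply: eq_bigr => l _; rewrite mulrA.
Qed.

Lemma raise_lower (a : 'I_n -> R) i z : D z ->
  \sum_l invmx (G z) i l * (\sum_m G z l m * a m) = a i.
Proof.
move=> Dz; under eq_bigr do rewrite mulr_sumr.
rewrite exchange_big /= -[RHS](sum_delta a); apply: eq_bigr => m _.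
by rewrite -(invG_mul _ _ Dz) mulr_suml; apply: eq_bigr => l _; rewrite mulrA.
Qed.

Lemma chr_sym l i j z : D z -> chr l i j z = chr l j i z.
Proof.
move=> Dz; rewrite /chr; congr (_ * _); apply: eq_bigr => k _; congr (_ * _).
by rewrite (dG_sym _ i j Dz) [X in X - _]addrC.
Qed.

Lemma chr_lower m i j z : D z ->
  \sum_l G z m l * chr l i j z =
  2^-1 * (d i (fun z => G z j m) z + d j (fun z => G z i m) z
     - d m (fun z => G z i j) z).
Proof.
move=> Dz; rewrite -(lower_raise (fun m => d i (fun z => G z j m) z + d j (fun z => G z i m) z
     - d m (fun z => G z i j) z) m Dz) mulr_sumr.
by apply: eq_bigr => l _; rewrite /chr mulrCA.
Qed.

(** The Levi-Civita connection is compatible with the metric. *)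
Lemma metric_compat k i j z : D z ->
  d k (fun z => G z i j) z =
  \sum_m G z j m * chr m k i z + \sum_m G z i m * chr m k j z.
Proof.
move=> Dz; rewrite !chr_lower // (dG_sym _ j i Dz) (dG_sym _ k i Dz) (dG_sym _ k j Dz).
by field.
Qed.

Section Function.
Variable u : V -> R.
Hypothesis su : smooth D u.

Lemma grad_lower i z : D z -> \sum_l G z i l * grad u l z = d i u z.
Proof. by move=> Dz; exact: lower_raise. Qed.

(** The Hessian of u as a bilinear form. *)
Definition covhess i j z : R := d i (d j u) z - \sum_k chr k i j z * d k u z.

Lemma covhess_sym i j z : D z -> covhess i j z = covhess j i z.
Proof.
move=> Dz; rewrite /covhess (derive_comm _ _ oD su Dz); congr (_ - _).
by apply: eq_bigr => k _; rewrite chr_sym.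
Qed.

(** Leibniz rule for du = G (grad u); the direction v may be the time. *)
Lemma dd_lower v j z : D z -> 'D_v (d j u) z =
  \sum_l ('D_v (fun z => G z j l) z * grad u l z + G z j l * 'D_v (grad u l) z).
Proof.
move=> Dz.
have -> : 'D_v (d j u) z = 'D_v (fun z => \sum_l G z j l * grad u l z) z.
  by apply: derive_eq_in Dz => // y Dy; rewrite grad_lower.
rewrite (dir_sum oD _ Dz); last first.
  by move=> l _; apply: smoothM => //; exact: smooth_grad.
by apply: eq_bigr => l _; rewrite (dirM _ Dz) //; exact: smooth_grad.
Qed.

(** The bilinear form is the endomorphism with its first index lowered. *)
Lemma covhessE i j z : D z -> covhess i j z = \sum_l G z j l * hess u l i z.
Proof.
move=> Dz; rewrite /covhess dd_lower // big_split /=.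
under eq_bigr do rewrite metric_compat // mulrDl.
rewrite big_split /=.
under [in RHS]eq_bigr do rewrite /hess mulrDr.
rewrite [in RHS]big_split /=.
have E1 : \sum_l (\sum_m G z j m * chr m i l z) * grad u l z =
   \sum_l G z j l * (\sum_m chr l i m z * grad u m z).
  under eq_bigr do rewrite mulr_suml.
  rewrite exchange_big /=; apply: eq_bigr => l _; rewrite mulr_sumr.
  by apply: eq_bigr => m _; rewrite mulrA.
have E2 : \sum_l (\sum_m G z l m * chr m i j z) * grad u l z =
   \sum_k chr k i j z * d k u z.
  under eq_bigr do rewrite mulr_suml.
  rewrite exchange_big /=; apply: eq_bigr => k _; rewrite -grad_lower // mulr_sumr.
  by apply: eq_bigr => m _; rewrite (G_sym m k Dz); ring.
rewrite E1 E2; ring.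
Qed.

End Function.
End Bochner.

(** * Bochner formula *)

(** The algebra behind the traced Ricci identity, at a point: C and dC stand for
the Christoffel symbols and their derivatives, X, dX and ddX for a vector field
and its derivatives, H and dH for its covariant derivative and the derivatives of
the latter. *)
Lemma ricci_identity_algebra (R : comNzRingType) n (C : 'I_n -> 'I_n -> 'I_n -> R)
    (dC : 'I_n -> 'I_n -> 'I_n -> 'I_n -> R) (X : 'I_n -> R)
    (dX : 'I_n -> 'I_n -> R) (ddX : 'I_n -> 'I_n -> 'I_n -> R)
    (H : 'I_n -> 'I_n -> R) (dH : 'I_n -> 'I_n -> 'I_n -> R) l :
  (forall k i j, C k i j = C k j i) ->
  (forall i j k, ddX i j k = ddX j i k) ->
  (forall k j, H k j = dX j k + \sum_m C k j m * X m) ->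
  (forall i k j, dH i k j = ddX i j k + \sum_m (dC i k j m * X m + C k j m * dX i m)) ->
  \sum_k (dH k k l + \sum_j C k k j * H j l - \sum_j H k j * C j k l) =
  \sum_k dH l k k + \sum_m (\sum_i (dC i i l m - dC l i i m
     + \sum_j (C i i j * C j l m - C i l j * C j i m))) * X m.
Proof.
move=> sC sdd EH EdH.
pose S := \sum_k ddX l k k.
pose a1 := \sum_k \sum_m dC k k l m * X m.
pose b1 := \sum_k \sum_m dC l k k m * X m.
pose a2 := \sum_k \sum_m C k l m * dX k m.
pose a3 := \sum_k \sum_m C k k m * dX l m.
pose a4 := \sum_k \sum_j \sum_m C k k j * C j l m * X m.
pose a6 := \sum_k \sum_j \sum_m C k l j * C j k m * X m.
have L1 : \sum_k dH k k l = S + (a1 + a2).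
  under eq_bigr do rewrite EdH big_split /=.
  by rewrite !big_split /=; congr (_ + _); apply: eq_bigr => k _.
have L2 : \sum_k \sum_j C k k j * H j l = a3 + a4.
  rewrite /a3 /a4 -big_split /=; apply: eq_bigr => k _.
  rewrite -big_split /=; apply: eq_bigr => j _.
  rewrite EH mulrDr mulr_sumr; congr (_ + _).
  by apply: eq_bigr => m _; rewrite mulrA.
have L3 : \sum_k \sum_j H k j * C j k l = a2 + a6.
  rewrite /a2 /a6 -big_split /= exchange_big /=; apply: eq_bigr => j _.
  rewrite -big_split /=; apply: eq_bigr => k _.
  rewrite EH mulrDl mulr_suml sC; congr (_ + _); first by rewrite mulrC.
  by apply: eq_bigr => m _; rewrite mulrC mulrA.
have R1 : \sum_k dH l k k = S + (b1 + a3).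
  under eq_bigr do rewrite EdH big_split /=.
  by rewrite !big_split.
have R2 : \sum_m (\sum_i (dC i i l m - dC l i i m
     + \sum_j (C i i j * C j l m - C i l j * C j i m))) * X m = a1 - b1 + (a4 - a6).
  under eq_bigr do rewrite mulr_suml.
  rewrite exchange_big /= /a1 /b1 /a4 /a6 -!sumrB -big_split /=.
  apply: eq_bigr => k _.
  rewrite [X in _ + (X - _)]exchange_big [X in _ + (_ - X)]exchange_big /=.
  rewrite -!sumrB -big_split /=; apply: eq_bigr => m _.
  rewrite mulrDl mulrBl mulr_suml; congr (_ + _).
  by rewrite -sumrB; apply: eq_bigr => j _; rewrite mulrBl.
rewrite sumrB big_split /= L1 L2 L3 R1 R2; ring.
Qed.

Section Bochner2.
Context {R : realType} {n : nat}.
Let V : normedModType R := (R * 'rV[R]_n)%type.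
Variables (D : set V) (oD : open D) (G : V -> 'M[R]_n).
Hypothesis sG : forall i j, smooth D (fun z => G z i j).
Hypothesis pG : forall z, D z -> posdef (G z).
Implicit Types (i j k l m : 'I_n) (z : V).
Local Notation d i u := ('D_(axis i) u).

Section Function.
Variable u : V -> R.
Hypothesis su : smooth D u.

Let sX l : smooth D (grad G u l).
Proof. exact: smooth_grad. Qed.
Let sC l i j : smooth D (chr G l i j).
Proof. exact: smooth_chr. Qed.
Let sH k l : smooth D (hess G u k l).
Proof. exact: smooth_hess. Qed.
Let sd i : smooth D (d i u).
Proof. exact: smooth_derive. Qed.

(** The differential of |grad u|^2 is 2 Hess u (., grad u). *)
Lemma d_energy i z : D z ->
  d i (energy G u) z = 2 * \sum_l grad G u l z * covhess G u i l z.
Proof.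
move=> Dz; rewrite /energy (dir_sum oD _ Dz); last first.
  by move=> l _; apply: smoothM => //; exact: sd.
under eq_bigr => l _ do rewrite (dirM _ Dz (sX l) (sd l)).
rewrite big_split /=.
have E0 : \sum_l d i (grad G u l) z * d l u z =
  \sum_l hess G u l i z * (\sum_m G z l m * grad G u m z) -
  \sum_l (\sum_m chr G l i m z * grad G u m z) * (\sum_m G z l m * grad G u m z).
  rewrite -sumrB; apply: eq_bigr => l _; rewrite -mulrBl /hess addrK; congr (_ * _).
  by rewrite (grad_lower pG).
have E1 : \sum_l hess G u l i z * (\sum_m G z l m * grad G u m z) =
  \sum_m grad G u m z * covhess G u i m z.
  under eq_bigr do rewrite mulr_sumr.
  rewrite exchange_big /=; apply: eq_bigr => m _.
  rewrite (covhessE oD sG pG su) // mulr_sumr; apply: eq_bigr => l _.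
  by rewrite (G_sym pG l m Dz); ring.
have E2 : \sum_l grad G u l z * d i (d l u) z = \sum_l grad G u l z * covhess G u i l z
   + \sum_l (\sum_m chr G l i m z * grad G u m z) * (\sum_m G z l m * grad G u m z).
  have cov l : d i (d l u) z = covhess G u i l z + \sum_k chr G k i l z * d k u z.
    by rewrite /covhess subrK.
  under eq_bigr do rewrite cov mulrDr.
  rewrite big_split /=; congr (_ + _).
  under eq_bigr do rewrite mulr_sumr.
  rewrite exchange_big /=; apply: eq_bigr => k _.
  rewrite (grad_lower pG) // mulr_suml; apply: eq_bigr => m _; ring.
rewrite E0 E2 E1; ring.
Qed.

(** The gradient of |grad u|^2 is 2 Hess u (grad u). *)
Lemma grad_energy k z : D z ->
  grad G (energy G u) k z = 2 * \sum_l hess G u k l z * grad G u l z.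
Proof.
move=> Dz; rewrite /grad.
under eq_bigr do rewrite d_energy // mulrCA.
rewrite -mulr_sumr; congr (_ * _).
under eq_bigr do rewrite mulr_sumr.
rewrite exchange_big /=; apply: eq_bigr => l _.
rewrite -(raise_lower pG (fun k => hess G u k l z) k Dz) mulr_suml.
apply: eq_bigr => m _.
by rewrite (covhess_sym oD pG su) // (covhessE oD sG pG su) // mulrA mulrAC.
Qed.

(** div (Hess u) = d (Delta u) + Ric (grad u, .). *)
Lemma ricci_identity l z : D z ->
  \sum_k (d k (hess G u k l) z + \sum_j chr G k k j z * hess G u j l z
     - \sum_j hess G u k j z * chr G j k l z) =
  d l (lap G u) z + \sum_m ric G l m z * grad G u m z.
Proof.
move=> Dz.
have dH i k j : d i (hess G u k j) z = d i (d j (grad G u k)) z +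
   \sum_m (d i (chr G k j m) z * grad G u m z + chr G k j m z * d i (grad G u m) z).
  rewrite /hess (dirD _ Dz) //; first last.
  - by apply: smooth_sum => // m _; apply: smoothM.
  - by apply: smooth_derive; exact: sX.
  congr (_ + _); rewrite (dir_sum oD _ Dz); last by move=> m _; apply: smoothM.
  by apply: eq_bigr => m _; rewrite (dirM _ Dz (sC k j m) (sX m)).
have -> : d l (lap G u) z = \sum_k d l (hess G u k k) z.
  by rewrite /lap (dir_sum oD _ Dz) // => k _; exact: sH.
rewrite /ric.
have := @ricci_identity_algebra R n (fun k i j => chr G k i j z)
  (fun a k i j => d a (chr G k i j) z) (fun m => grad G u m z)
  (fun i k => d i (grad G u k) z) (fun i j k => d i (d j (grad G u k)) z)
  (fun k j => hess G u k j z) (fun i k j => d i (hess G u k j) z) l.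
apply.
- by move=> k i j; rewrite (chr_sym oD pG).
- by move=> i j k; exact: (derive_comm _ _ oD (sX k) Dz).
- by [].
- by move=> i k j; exact: dH.
Qed.

(** Bochner formula; the first term on the right is |Hess u|^2. *)
Lemma bochner z : D z ->
  lap G (energy G u) z = 2 * (\sum_k \sum_l hess G u k l z * hess G u l k z +
    \sum_l grad G u l z * (d l (lap G u) z + \sum_m ric G l m z * grad G u m z)).
Proof.
move=> Dz.
have sHX k l : smooth D (fun z => hess G u k l z * grad G u l z).
  by apply: smoothM.
have E k : hess G (energy G u) k k z =
   2 * (\sum_l (d k (hess G u k l) z * grad G u l z + hess G u k l z * d k (grad G u l) z)
    + \sum_j chr G k k j z * \sum_l hess G u j l z * grad G u l z).
  rewrite {1}/hess mulrDr; congr (_ + _).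
    have -> : d k (grad G (energy G u) k) z = d k (fun z => 2 * \sum_l hess G u k l z * grad G u l z) z.
      by apply: derive_eq_in Dz => // y Dy; rewrite grad_energy.
    rewrite (dirZ _ Dz); last by apply: smooth_sum.
    congr (_ * _); rewrite (dir_sum oD _ Dz) //.
    by apply: eq_bigr => l _; rewrite (dirM _ Dz (sH k l) (sX l)).
  rewrite mulr_sumr; apply: eq_bigr => j _.
  by rewrite grad_energy // mulrCA.
rewrite /lap; under eq_bigr do rewrite E.
rewrite -mulr_sumr; congr (_ * _).
have dX k l : d k (grad G u l) z = hess G u l k z - \sum_m chr G l k m z * grad G u m z.
  by rewrite /hess addrK.
under [X in _ = _ + X]eq_bigr => l _ do rewrite -ricci_identity // mulr_sumr.
rewrite [X in _ = _ + X]exchange_big /= -big_split /=; apply: eq_bigr => k _.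
have -> : \sum_j chr G k k j z * (\sum_l hess G u j l z * grad G u l z) =
  \sum_l grad G u l z * (\sum_j chr G k k j z * hess G u j l z).
  under eq_bigr do rewrite mulr_sumr.
  under [RHS]eq_bigr do rewrite mulr_sumr.
  rewrite exchange_big /=; apply: eq_bigr => l _; apply: eq_bigr => j _; ring.
have E2 : \sum_l hess G u k l z * d k (grad G u l) z =
   \sum_l hess G u k l z * hess G u l k z -
   \sum_l grad G u l z * \sum_j hess G u k j z * chr G j k l z.
  under eq_bigr do rewrite dX mulrBr.
  rewrite sumrB; congr (_ - _).
  under eq_bigr do rewrite mulr_sumr.
  under [RHS]eq_bigr do rewrite mulr_sumr.
  rewrite exchange_big /=; apply: eq_bigr => l _; apply: eq_bigr => j _; ring.
rewrite big_split /= E2.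
under [X in _ = _ + X]eq_bigr => l _ do rewrite mulrBr mulrDr.
rewrite [X in _ = _ + X]sumrB [X in _ = _ + (X - _)]big_split /=.
under [X in X + _ + _ = _]eq_bigr => l _ do rewrite mulrC.
ring.
Qed.

End Function.
End Bochner2.

(** * Evolution of the energy density *)

(** A directional derivative is linear in the direction. *)
Lemma dir_linear (R : realType) (V : normedModType R) (D : set V) (F : V -> R) x
    (I : Type) (s : seq I) (c : I -> R) (v : I -> V) :
  open D -> smooth D F -> D x ->
  'D_(\sum_(i <- s) c i *: v i) F x = \sum_(i <- s) c i * 'D_(v i) F x.
Proof.
move=> oD sF Dx.
have H : h^-1 * (F (x + h *: \sum_(i <- s) c i *: v i) - F x) @[h --> (0:R)^'] -->
    \sum_(i <- s) c i * 'D_(v i) F x.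
  apply: (cvg_dir_sum (D := D) (c := fun i _ => c i)) => //.
  - by move=> i y Dy; exact: smooth_derivable sF Dy.
  - move=> i; exact: (smooth_continuous (smooth_derive (v i) sF) Dx).
  - move=> i; exact: cvg_cst.
apply: cvg_lim => //; apply: cvg_trans H; apply: near_eq_cvg; near=> h.
by rewrite /= [_ + x]addrC.
Unshelve. all: by end_near. Qed.

Section Evolution.
Context {R : realType} {n : nat}.
Let V : normedModType R := (R * 'rV[R]_n)%type.
Variables (D : set V) (oD : open D) (G : V -> 'M[R]_n).
Hypothesis sG : forall i j, smooth D (fun z => G z i j).
Hypothesis pG : forall z, D z -> posdef (G z).
Implicit Types (i j k l m : 'I_n) (z : V).
Local Notation d i u := ('D_(axis i) u).

Lemma energy_ge0 u z : D z -> 0 <= energy G u z.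
Proof.
move=> Dz; rewrite /energy.
have [_ pP] := posdef_inv (pG Dz).
pose v : 'rV[R]_n := \row_i d i u z.
have -> : \sum_l grad G u l z * d l u z = (v *m invmx (G z) *m v^T) 0 0.
  rewrite mxE; apply: eq_bigr => l _; rewrite !mxE; congr (_ * _).
  have [sP _] := posdef_inv (pG Dz).
  apply: eq_bigr => m _; rewrite !mxE mulrC; congr (_ * _).
  by rewrite -[in LHS]sP mxE.
have [->|v0] := eqVneq v 0; first by rewrite !mul0mx mxE.
exact/ltW/pP.
Qed.

(** The Laplacian is a second-order operator without zeroth-order term, whose
principal part is the inverse metric. *)
Lemma lap_split u z : smooth D u -> D z ->
  lap G u z = \sum_i \sum_m invmx (G z) i m * d i (d m u) z +
   \sum_m (\sum_i (d i (fun z => invmx (G z) i m) z +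
      \sum_j chr G i i j z * invmx (G z) j m)) * d m u z.
Proof.
move=> su Dz.
have sP := smooth_inv oD sG pG.
have sd m : smooth D (d m u) by exact: smooth_derive.
under [X in _ = _ + X]eq_bigr do rewrite mulr_suml.
rewrite [X in _ = _ + X]exchange_big -big_split /=.
rewrite /lap; apply: eq_bigr => i _.
rewrite {1}/hess {1}/grad (dir_sum oD _ Dz); last first.
  by move=> m _; exact: (smoothM oD (sP i m) (sd m)).
under [X in X + _ = _]eq_bigr => m _ do rewrite (dirM _ Dz (sP i m) (sd m)).
rewrite big_split /= [X in X + _ = _]addrC -addrA; congr (_ + _).
under [X in _ = X]eq_bigr do rewrite mulrDl.
rewrite [RHS]big_split /=; congr (_ + _).
under [RHS]eq_bigr do rewrite mulr_suml.
rewrite exchange_big /=; apply: eq_bigr => j _.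
by rewrite /grad mulr_sumr; apply: eq_bigr => m _; rewrite mulrA.
Qed.

(** Second derivative test for the Laplacian at a spatial maximum. *)
Lemma lap_max u z : smooth D u -> D z ->
  (forall w : 'rV[R]_n, \forall h \near (0 : R), u (z + h *: ((0, w) : V)) <= u z) ->
  lap G u z <= 0.
Proof.
move=> su Dz Hmax.
have Ew (w : 'rV[R]_n) : ((0, w) : V) = \sum_i w 0 i *: axis i.
  have E1 (s : seq 'I_n) : \sum_(i <- s) w 0 i *: axis i =
     ((0, \sum_(i <- s) w 0 i *: delta_mx 0 i) : V).
    elim: s => [|i s IH]; first by rewrite !big_nil.
    by rewrite !big_cons IH /axis; congr pair; rewrite /= scaler0 addr0.
  by rewrite E1; congr pair; exact: row_sum_delta.
have dw w y : D y -> 'D_((0, w) : V) u y = \sum_i w 0 i * d i u y.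
  by move=> Dy; rewrite Ew (dir_linear _ _ _ oD su Dy).
have d0 i : d i u z = 0.
  by have [] := derive_max oD su Dz (Hmax (delta_mx 0 i)).
rewrite lap_split // [X in _ + X]big1 ?addr0; last by move=> m _; rewrite d0 mulr0.
pose N : 'M[R]_n := \matrix_(i, j) d i (d j u) z.
have -> : \sum_i \sum_m invmx (G z) i m * d i (d m u) z = \sum_i \sum_m invmx (G z) i m * N i m.
  by apply: eq_bigr => i _; apply: eq_bigr => m _; rewrite mxE.
apply: (posdef_sum_le0 (posdef_inv (pG Dz))) => v.
have [_] := derive_max oD su Dz (Hmax v).
have sd m : smooth D (d m u) by exact: smooth_derive.
have svd m : smooth D (fun y => v 0 m * d m u y).
  exact: (smoothM oD (smooth_cst D (v 0 m)) (sd m)).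
rewrite (derive_eq_in oD _ (dw v) Dz) (dir_sum oD _ Dz) //.
congr (_ <= _); rewrite [RHS]exchange_big; apply: eq_bigr => j _.
rewrite (dirZ _ Dz _ (sd j)) Ew (dir_linear _ _ _ oD (sd j) Dz) mulr_sumr.
by apply: eq_bigr => i _; rewrite mxE mulrCA mulrA.
Qed.

(** |Hess u|^2 is non-negative. *)
Lemma trace_hess_ge0 u z : smooth D u -> D z ->
  0 <= \sum_k \sum_l hess G u k l z * hess G u l k z.
Proof.
move=> su Dz.
have pP := posdef_inv (pG Dz).
pose S : 'M[R]_n := \matrix_(i, j) covhess G u i j z.
have sS : S^T = S.
  by apply/matrixP => i j; rewrite !mxE (covhess_sym oD pG su).
have := mxtrace_posdef_sqr pP sS; congr (_ <= _).
have E k l : hess G u k l z = (invmx (G z) *m S) k l.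
  rewrite mxE -(raise_lower pG (fun k => hess G u k l z) k Dz).
  apply: eq_bigr => m _; rewrite mxE; congr (_ * _).
  by rewrite (covhess_sym oD pG su) // (covhessE oD sG pG su).
rewrite /mxtrace; apply: eq_bigr => k _; rewrite mxE; apply: eq_bigr => l _.
by rewrite -!E.
Qed.

(** From here on, G moves along the direction tt by the Ricci flow and f solves
the heat equation. *)
Variables (tt : V) (f : V -> R).
Hypothesis sf : smooth D f.
Hypothesis flow : forall z i j, D z -> 'D_tt (fun z => G z i j) z = - ric G i j z.
Hypothesis heat : forall z, D z -> 'D_tt f z = 2^-1 * lap G f z.

Lemma dt_energy z : D z -> 'D_tt (energy G f) z =
  \sum_l grad G f l z * (d l (lap G f) z + \sum_m ric G l m z * grad G f m z).
Proof.
move=> Dz.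
have sX l : smooth D (grad G f l) by exact: smooth_grad.
have sd l : smooth D (d l f) by exact: smooth_derive.
rewrite /energy (dir_sum oD _ Dz); last first.
  by move=> l _; exact: (smoothM oD (sX l) (sd l)).
under eq_bigr => l _ do rewrite (dirM _ Dz (sX l) (sd l)).
rewrite big_split /=.
have E1 : \sum_l 'D_tt (grad G f l) z * d l f z =
  \sum_m grad G f m z * ('D_tt (d m f) z + \sum_l ric G m l z * grad G f l z).
  have E2 m : 'D_tt (d m f) z + \sum_l ric G m l z * grad G f l z =
     \sum_l G z m l * 'D_tt (grad G f l) z.
    rewrite (dd_lower oD sG pG sf) // -big_split /=; apply: eq_bigr => l _.
    rewrite flow //; ring.
  under [RHS]eq_bigr do rewrite E2 mulr_sumr.
  rewrite exchange_big /=; apply: eq_bigr => l _.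
  rewrite -(grad_lower pG) // mulr_sumr; apply: eq_bigr => m _.
  rewrite (G_sym pG l m Dz); ring.
rewrite E1 -big_split /=; apply: eq_bigr => l _.
have -> : 'D_tt (d l f) z = 2^-1 * d l (lap G f) z.
  rewrite (derive_comm _ _ oD sf Dz) -(dirZ _ Dz); last exact: smooth_lap.
  by apply: derive_eq_in Dz => // y Dy; exact: heat.
rewrite -mulrDr; congr (_ * _); by field.
Qed.

(** (d/dt - Delta/2) |grad f|^2 = - |Hess f|^2 <= 0. *)
Lemma energy_subsolution z : D z ->
  'D_tt (energy G f) z <= 2^-1 * lap G (energy G f) z.
Proof.
move=> Dz; rewrite dt_energy // (bochner oD sG pG sf Dz) mulKf ?pnatr_eq0 //.
by rewrite lerDr; exact: trace_hess_ge0.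
Qed.

Lemma lap_sqr z : D z -> lap G (fun z => f z * f z) z =
  2 * (f z * lap G f z + energy G f z).
Proof.
move=> Dz.
have sX l : smooth D (grad G f l) by exact: smooth_grad.
have E l y : D y -> grad G (fun z => f z * f z) l y = 2 * (f y * grad G f l y).
  move=> Dy; rewrite /grad !mulr_sumr; apply: eq_bigr => m _.
  rewrite (dirM _ Dy sf sf); ring.
rewrite /lap /energy mulr_sumr -big_split mulr_sumr /=; apply: eq_bigr => k _.
rewrite /hess (derive_eq_in oD _ (E k) Dz) (dirZ _ Dz); last exact: smoothM.
rewrite (dirM _ Dz sf (sX k)).
under eq_bigr => m _ do rewrite E //.
have -> : \sum_m chr G k k m z * (2 * (f z * grad G f m z)) =
   2 * f z * \sum_m chr G k k m z * grad G f m z.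
  by rewrite mulr_sumr; apply: eq_bigr => m _; ring.
ring.
Qed.

Lemma lapD u v z : smooth D u -> smooth D v -> D z ->
  lap G (fun z => u z + v z) z = lap G u z + lap G v z.
Proof.
move=> su sv Dz.
have sX w l : smooth D w -> smooth D (grad G w l) by move=> sw; exact: smooth_grad.
have E l y : D y -> grad G (fun z => u z + v z) l y = grad G u l y + grad G v l y.
  move=> Dy; rewrite /grad -big_split /=; apply: eq_bigr => m _.
  by rewrite (dirD _ Dy su sv) mulrDr.
rewrite /lap -big_split /=; apply: eq_bigr => k _.
rewrite /hess (derive_eq_in oD _ (E k) Dz) (dirD _ Dz (sX u k su) (sX v k sv)).
under eq_bigr => m _ do rewrite E // mulrDr.
rewrite big_split /=; ring.
Qed.

(** The coefficient a depends on time only. *)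
Lemma lapZ a u z : smooth D a -> (forall i y, D y -> d i a y = 0) -> smooth D u -> D z ->
  lap G (fun z => a z * u z) z = a z * lap G u z.
Proof.
move=> sa a0 su Dz.
have sX l : smooth D (grad G u l) by exact: smooth_grad.
have E l y : D y -> grad G (fun z => a z * u z) l y = a y * grad G u l y.
  move=> Dy; rewrite /grad mulr_sumr; apply: eq_bigr => m _.
  rewrite (dirM _ Dy sa su) a0 //; ring.
rewrite /lap mulr_sumr /=; apply: eq_bigr => k _.
rewrite /hess (derive_eq_in oD _ (E k) Dz) (dirM _ Dz sa (sX k)) a0 //.
under eq_bigr => m _ do rewrite E // mulrCA.
by rewrite -mulr_sumr mul0r add0r mulrDr.
Qed.

(** Subsolutions a(t) |grad f|^2 + b f^2 with da/dt <= b: the term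
(da/dt) |grad f|^2 is absorbed by (d/dt - Delta/2) f^2 = - |grad f|^2. *)
Lemma combined_subsolution a (b : R) z :
  smooth D a -> (forall i y, D y -> d i a y = 0) ->
  D z -> 0 <= a z -> 'D_tt a z <= b ->
  'D_tt (fun z => a z * energy G f z + b * (f z * f z)) z <=
  2^-1 * lap G (fun z => a z * energy G f z + b * (f z * f z)) z.
Proof.
move=> sa a0 Dz az ab.
have sE := smooth_energy oD sG pG sf.
have sff : smooth D (fun z => f z * f z) by exact: smoothM.
have saE : smooth D (fun z => a z * energy G f z) by exact: smoothM.
have sb : smooth D (fun=> b) by exact: smooth_cst.
have sbf : smooth D (fun z => b * (f z * f z)) by exact: smoothM.
rewrite lapD // lapZ // lapZ //; last by move=> i y _; exact: derive_cst.
rewrite lap_sqr // (dirD _ Dz saE sbf) (dirM _ Dz sa sE) (dirZ _ Dz b sff) (dirM _ Dz sf sf).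
rewrite heat //.
have H := energy_subsolution Dz.
have H0 := energy_ge0 f Dz.
have H1 : a z * 'D_tt (energy G f) z <= a z * (2^-1 * lap G (energy G f) z).
  by rewrite ler_wpM2l.
have H2 : 'D_tt a z * energy G f z <= b * energy G f z by rewrite ler_wpM2r.
set e := energy G f z in H1 H2 *; set l1 := lap G f z; set l2 := lap G _ z in H1 *.
set x1 := 'D_tt a z in H2 *; set x2 := 'D_tt _ z in H1 *.
have -> : 2^-1 * (a z * l2 + b * (2 * (f z * l1 + e))) =
  a z * (2^-1 * l2) + b * e + b * (2^-1 * l1 * f z + f z * (2^-1 * l1)) by field.
by rewrite lerD2r addrC; apply: lerD.
Qed.

End Evolution.

(** * Coordinate expressions of the flow and of the solution *)

Section Slices.
Context {R : realType} {n : nat}.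
Let V : normedModType R := (R * 'rV[R]_n)%type.
Implicit Types (t : R) (y : 'rV[R]_n).

(** The time direction. *)
Definition time : V := (1, 0).

Lemma axis_shift i h t y : h *: axis i + ((t, y) : V) = (t, h *: delta_mx 0 i + y).
Proof. by apply: injective_projections; rewrite /= ?scaler0 ?add0r. Qed.

Lemma time_shift h t y : h *: time + ((t, y) : V) = (h *: 1 + t, y).
Proof. by apply: injective_projections; rewrite /= ?scaler0 ?add0r. Qed.

Lemma derive_space (F : V -> R) i t y :
  'D_(delta_mx 0 i) (fun y => F (t, y)) y = 'D_(axis i) F (t, y).
Proof.
suff E : (fun h : R => h^-1 *: (((fun y => F (t, y)) \o shift y) (h *: delta_mx 0 i) - F (t, y))) =
 (fun h : R => h^-1 *: ((F \o shift ((t, y) : V)) (h *: axis i) - F (t, y))).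
  by rewrite /derive E.
by apply/funext => h /=; rewrite axis_shift.
Qed.

Lemma derivable_space (F : V -> R) i t y : derivable F (t, y) (axis i) ->
  derivable (fun y => F (t, y)) y (delta_mx 0 i).
Proof.
rewrite /derivable.
suff -> : (fun h : R => h^-1 *: (((fun y => F (t, y)) \o shift y) (h *: delta_mx 0 i) - F (t, y))) =
 (fun h : R => h^-1 *: ((F \o shift ((t, y) : V)) (h *: axis i) - F (t, y))) by [].
by apply/funext => h /=; rewrite axis_shift.
Qed.

Lemma derive_time (F : V -> R) t y :
  'D_1 (fun s => F (s, y)) t = 'D_time F (t, y).
Proof.
suff E : (fun h : R => h^-1 *: (((fun s => F (s, y)) \o shift t) (h *: 1) - F (t, y))) =
 (fun h : R => h^-1 *: ((F \o shift ((t, y) : V)) (h *: time) - F (t, y))).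
  by rewrite /derive E.
by apply/funext => h /=; rewrite time_shift.
Qed.

Variable G : V -> 'M[R]_n.

Lemma christoffelE l i j t y :
  christoffel (fun y => G (t, y)) l i j y = chr G l i j (t, y).
Proof.
rewrite /christoffel /chr; congr (_ * _); apply: eq_bigr => k _.
by rewrite /partial !(derive_space (fun z => G z _ _)).
Qed.

Lemma ricciE j k t y :
  ricci (fun y => G (t, y)) y j k = ric G j k (t, y).
Proof.
have E l i j' : christoffel (fun y => G (t, y)) l i j' = fun y => chr G l i j' (t, y).
  by apply/funext => y'; exact: christoffelE.
rewrite /ricci mxE /ric; apply: eq_bigr => i _.
rewrite /riemann /partial !E !derive_space; congr (_ + _).
by apply: eq_bigr => m _; rewrite !christoffelE.
Qed.

Lemma gradientE u t y :
  gradient (fun y => G (t, y)) (fun y => u (t, y)) y = \row_i grad G u i (t, y).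
Proof.
apply/matrixP => o i; rewrite !mxE /grad; apply: eq_bigr => j _.
by rewrite /partial derive_space.
Qed.

Lemma laplacianE u t y :
  laplacian (fun y => G (t, y)) (fun y => u (t, y)) y = lap G u (t, y).
Proof.
rewrite /laplacian /divergence /lap; apply: eq_bigr => i _.
have E : (fun z => gradient (fun y => G (t, y)) (fun y => u (t, y)) z 0 i) =
  fun y => grad G u i (t, y).
  by apply/funext => z; rewrite gradientE mxE.
rewrite /hess /partial E derive_space; congr (_ + _).
by apply: eq_bigr => j _; rewrite christoffelE gradientE mxE.
Qed.

End Slices.

(** |grad u|^2 is the quadratic form of the inverse metric at du. *)
Lemma energyE (R : realType) (n : nat) (G : R * 'rV[R]_n -> 'M[R]_n)
    (u : R * 'rV[R]_n -> R) z : posdef (G z) ->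
  energy G u z = ((\row_i 'D_(axis i) u z) *m invmx (G z) *m (\row_i 'D_(axis i) u z)^T) 0 0.
Proof.
move=> pGz; have [sP _] := posdef_inv pGz.
rewrite mxE; apply: eq_bigr => l _; rewrite !mxE; congr (_ * _).
by apply: eq_bigr => m _; rewrite !mxE mulrC; congr (_ * _); rewrite -[in LHS]sP mxE.
Qed.

Lemma open_product (T U : topologicalType) (A : set T) (B : set U) :
  open A -> open B -> open (A `*` B).
Proof.
move=> oA oB; rewrite openE => -[x y] [/= Ax By].
by exists (A, B) => //; split; exact: open_nbhs_nbhs.
Qed.

Section Flow.
Context {R : realType} {n : nat} (M : smoothManifold R n).
Variables (Tc : \bar R) (g : R -> tensor_field M) (f0 : M -> R) (f : R -> M -> R).
Hypothesis flow : ricci_flow Tc g.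
Hypothesis heat : heat_solution Tc g f0 f.
Let V : normedModType R := (R * 'rV[R]_n)%type.
Implicit Types (a b : atlas M) (p : M) (t : R) (y : 'rV[R]_n).

(** The metric and the solution in the chart a, as functions of (t, y). *)
Definition metric_coord a (z : V) : 'M[R]_n := in_coord a (g z.1 a) z.2.
Definition fun_coord a (z : V) : R := in_coord a (f z.1) z.2.

(** The positive times and the coordinates of the chart a, where the flow and the
solution are smooth. *)
Definition interior_dom a : set V :=
  [set t | 0 < t /\ (t%:E < Tc)%E] `*` chart_cod (coord a).

Lemma open_lifespan : open [set t : R | 0 < t /\ (t%:E < Tc)%E].
Proof.
have -> : [set t : R | 0 < t /\ (t%:E < Tc)%E] = [set t | 0 < t] `&` [set t | (t%:E < Tc)%E] by [].
apply: openI; first exact: open_gt.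
case: Tc => [r| |].
- by under eq_set do rewrite lte_fin; exact: open_lt.
- suff -> : [set t : R | (t%:E < +oo)%E] = setT by exact: openT.
  by apply/seteqP; split => // t _ /=; rewrite ltry.
- suff -> : [set t : R | (t%:E < -oo)%E] = set0 by exact: open0.
  by apply/seteqP; split => // t /=; rewrite ltNye.
Qed.

Lemma open_interior_dom a : open (interior_dom a).
Proof. by apply: open_product; [exact: open_lifespan|exact: chart_cod_open]. Qed.

Lemma interior_domW a : interior_dom a `<=` lifespan Tc `*` chart_cod (coord a).
Proof. by move=> [t y] [[/= t0 tT] cy]; split=> //; split=> //; exact: ltW. Qed.

(** Positivity also holds at time 0. *)
Lemma metric_posdef a t y : lifespan Tc t -> chart_cod (coord a) y ->
  posdef (metric_coord a (t, y)).
Proof.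
move=> Lt cy; have [H _ _] := flow; have [Hs Hp _ _] := H t Lt.
have dy := chart_invS cy.
by split; [exact: Hs|move=> v v0; exact: Hp].
Qed.

Lemma metric_posdef_in a z : interior_dom a z -> posdef (metric_coord a z).
Proof. by move=> /interior_domW; case: z => t y [Lt cy]; exact: metric_posdef. Qed.

Lemma smooth_metric a i j : smooth (interior_dom a) (fun z => metric_coord a z i j).
Proof.
have [_ /(_ a i j) H _] := flow.
have K := smooth_on_smooth (@open_interior_dom a) (@interior_domW a) H.
exact K.
Qed.

Lemma smooth_fun a : smooth (interior_dom a) (fun_coord a).
Proof.
have [_ _ /(_ a) H _] := heat.
have K := smooth_on_smooth (@open_interior_dom a) (@subset_refl _ _) H.
exact K.
Qed.

Lemma flow_coord a z i j : interior_dom a z ->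
  'D_time (fun z => metric_coord a z i j) z = - ric (metric_coord a) i j z.
Proof.
case: z => t y Dz; have [/= [t0 tT] cy] := Dz.
have Lt : lifespan Tc t by split => //; exact: ltW.
have [_ _ H] := flow.
have dy := chart_invS cy.
have {H} := H t a _ i j Lt dy.
rewrite /ricci_tensor chart_invK // => H.
rewrite -(derive_time (fun z => metric_coord a z i j)) -ricciE.
have sub : [set t : R | 0 < t /\ (t%:E < Tc)%E] `<=` lifespan Tc.
  by move=> s [/ltW].
have [_ E] := is_derive_withinP open_lifespan sub (conj t0 tT) H.
exact: E.
Qed.

Lemma heat_coord a z : interior_dom a z ->
  'D_time (fun_coord a) z = 2^-1 * lap (metric_coord a) (fun_coord a) z.
Proof.
case: z => t y Dz; have [/= [t0 tT] cy] := Dz.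
have [_ _ _ H] := heat.
have [_ E] := H t a _ t0 tT (chart_invS cy).
rewrite -(derive_time (fun_coord a)) E /laplace_beltrami chart_invK //.
by rewrite -laplacianE.
Qed.

End Flow.

(** * Independence of the energy density from the chart *)

Lemma pair_cvg (T U : topologicalType) (t : T) (y : U) :
  (fun z => (t, z)) @ y --> (t, y).
Proof.
move=> A [[B C] /= [nB nC] BC].
suff : \forall z \near y, A (t, z) by [].
apply: filterS (nC : \forall z \near y, C z) => z Cz; apply: BC.
by split=> //=; exact: nbhs_singleton nB.
Qed.

Section ChartChange.
Context {R : realType} {n : nat} (M : smoothManifold R n).
Implicit Types (a b : atlas M) (p : M) (t : R) (y : 'rV[R]_n).

(** u is of class C^1 on M: in every chart it has continuous partial derivatives. *)
Definition C1 (u : M -> R) : Prop := forall b (j : 'I_n) y, chart_cod (coord b) y ->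
  derivable (in_coord b u) y (delta_mx 0 j) /\
  {for y, continuous ('D_(delta_mx 0 j) (in_coord b u))}.

Lemma open_overlap a b : open (chart_cod (coord a) `&`
         [set y | chart_dom (coord b) (chart_inv (coord a) y)]).
Proof.
have H : {within chart_cod (coord a), continuous (chart_inv (coord a))}.
  exact: chart_inv_continuous.
rewrite continuous_open_subspace in H; last exact: chart_cod_open.
move/continuous_inP : H; apply; [exact: chart_cod_open|exact: chart_dom_open].
Qed.

(** Chain rule for a change of charts. *)
Lemma partial_change (u : M -> R) a b p i : C1 u ->
  chart_dom (coord a) p -> chart_dom (coord b) p ->
  partial i (in_coord a u) (coord a p) =
  \sum_j transition_jacobian a b p i j * partial j (in_coord b u) (coord b p).
Proof.
move=> C1u ap bp.
pose W := chart_cod (coord a) `&` [set y | chart_dom (coord b) (chart_inv (coord a) y)].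
have oW : open W by exact: open_overlap.
set y := coord a p.
have Wy : W y by split; [exact: chart_funS|rewrite /= chart_funK].
pose tau (y : 'rV[R]_n) := coord b (chart_inv (coord a) y).
have Ey : tau y = coord b p by rewrite /tau chart_funK.
pose e : 'rV[R]_n := delta_mx 0 i.
(* the transition map moves along x + h \sum_j c_j(h) e_j *)
pose c (j : 'I_n) (h : R) := h^-1 * (tau (h *: e + y) 0 j - tau y 0 j).
have dtau j : derivable (fun z => tau z 0 j) y e.
  have sT := smooth_on_smooth oW (@subset_refl _ _) (transition_smooth a b j).
  exact: (smooth_derivable sT Wy).
have cj j : c j h @[h --> (0:R)^'] --> transition_jacobian a b p i j.
  rewrite mxE; exact: (dtau j).
have H : h^-1 * (in_coord b u
        (coord b p + h *: \sum_(j <- index_enum 'I_n) c j h *: delta_mx 0 j)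
      - in_coord b u (coord b p))
     @[h --> (0:R)^'] -->
    \sum_j transition_jacobian a b p i j * partial j (in_coord b u) (coord b p).
  apply: (cvg_dir_sum (D := chart_cod (coord b))).
  - exact: chart_cod_open.
  - exact: chart_funS.
  - by move=> j z /(C1u b j z)[].
  - by move=> j; have [] := C1u b j _ (chart_funS bp).
  - exact: cj.
apply: cvg_lim => //; apply: cvg_trans H; apply: near_eq_cvg.
have nW : \forall h \near (0:R)^', W (y + h *: e).
  by apply: nbhs_dnbhs; exact: open_line.
near=> h.
have h0 : h != 0 by near: h; exact: nbhs_dnbhs_neq.
have [_ /= dh] : W (y + h *: e) by near: h.
have -> : coord b p + h *: \sum_(j < n) c j h *: delta_mx 0 j = tau (y + h *: e).
  have -> : \sum_(j < n) c j h *: delta_mx 0 j = h^-1 *: (tau (y + h *: e) - tau y).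
    rewrite [RHS]row_sum_delta; apply: eq_bigr => j _; congr (_ *: _).
    by rewrite !mxE /c [h *: e + y]addrC.
  by rewrite scalerA mulfV // scale1r -Ey addrC subrK.
rewrite /= /GRing.scale /= [h *: e + y]addrC; congr (_ * (_ - _)).
  by rewrite /in_coord /tau chart_funK.
by rewrite /in_coord !chart_funK.
Unshelve. all: by end_near. Qed.

(** The quadratic form of the inverse metric is invariant under a change of
coordinates of Jacobian J. *)
Lemma energy_matrix_change (A B J : 'M[R]_n) (v w : 'rV[R]_n) :
  posdef A -> A = J *m B *m J^T -> v = w *m J^T ->
  v *m invmx A *m v^T = w *m invmx B *m w^T.
Proof.
move=> /posdef_unit uA EA ->.
have := uA; rewrite EA !unitmx_mul => /andP[/andP[uJ uB] uJT].
rewrite -EA trmx_mul trmxK.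
have -> : invmx A = invmx J^T *m invmx B *m invmx J.
  apply: (can_inj (mulKmx uA)); rewrite mulmxV // EA !mulmxA.
  by rewrite mulmxK // mulmxK // mulmxV.
by rewrite !mulmxA mulmxK // mulmxKV.
Qed.

Section Flow.
Variables (Tc : \bar R) (g : R -> tensor_field M) (f0 : M -> R) (f : R -> M -> R).
Hypothesis flow : ricci_flow Tc g.
Hypothesis heat : heat_solution Tc g f0 f.

Lemma C1_pos t : 0 < t -> (t%:E < Tc)%E -> C1 (f t).
Proof.
move=> t0 tT b j y cy.
have Dz : interior_dom Tc b (t, y) by [].
have sf := smooth_fun heat b.
have dF : 'D_(delta_mx 0 j) (in_coord b (f t)) = fun y => 'D_(axis j) (fun_coord f b) (t, y).
  by apply/funext => z; rewrite -(derive_space (fun_coord f b)).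
split.
  exact: (derivable_space (F := fun_coord f b) (smooth_derivable sf Dz)).
rewrite dF.
have H := smooth_continuous (smooth_derive (axis j) sf) Dz.
apply: (@continuous_comp _ _ _ (fun y => (t, y)) ('D_(axis j) (fun_coord f b))) H.
exact: pair_cvg.
Qed.

(** The squared norm of the gradient, computed in the chart a. *)
Definition local_energy a (z : R * 'rV[R]_n) : R :=
  energy (metric_coord g a) (fun_coord f a) z.

Lemma local_energy_change a b p t : lifespan Tc t -> C1 (f t) ->
  chart_dom (coord a) p -> chart_dom (coord b) p ->
  local_energy a (t, coord a p) = local_energy b (t, coord b p).
Proof.
move=> Lt C1t ap bp.
have pa := metric_posdef flow Lt (chart_funS ap).
have pb := metric_posdef flow Lt (chart_funS bp).
rewrite /local_energy !energyE //.
congr (fun_of_matrix _ 0 0).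
apply: (energy_matrix_change (J := transition_jacobian a b p)) => //.
  have [H _ _] := flow; have [_ _ Hc _] := H t Lt.
  by rewrite /metric_coord /in_coord /= !chart_funK //; exact: Hc.
apply/matrixP => o i; rewrite !mxE.
rewrite -(derive_space (fun_coord f a)).
have /= := partial_change i C1t ap bp; rewrite /partial => ->.
apply: eq_bigr => j _; rewrite !mxE -(derive_space (fun_coord f b)).
by rewrite mulrC.
Qed.

(** The squared norm of the gradient of f(t,.) at p, computed in the preferred
chart at p. *)
Definition global_energy t p : R := local_energy (chart_at p) (t, coord (chart_at p) p).

Lemma global_energyE a p t : lifespan Tc t -> C1 (f t) -> chart_dom (coord a) p ->
  global_energy t p = local_energy a (t, coord a p).
Proof. by move=> Lt C1t ap; apply: local_energy_change => //; exact: chart_atP. Qed.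

Lemma gradient_normE t p : lifespan Tc t ->
  gradient_norm (g t) (f t) p = Num.sqrt (global_energy t p).
Proof.
move=> Lt; rewrite /gradient_norm /riemannian_norm; congr Num.sqrt.
set a := chart_at p.
have ap : chart_dom (coord a) p by exact: chart_atP.
have pa := metric_posdef flow Lt (chart_funS ap).
rewrite /global_energy -/a /local_energy energyE //.
have := gradientE (metric_coord g a) (fun_coord f a) t (coord a p).
rewrite [X in gradient X _](_ : _ = in_coord a (g t a)) //.
rewrite [X in gradient _ X](_ : _ = in_coord a (f t)) // => ->.
set v := \row_i 'D_(axis i) (fun_coord f a) _.
have Eg : g t a p = metric_coord g a (t, coord a p).
  by rewrite /metric_coord /in_coord /= chart_funK.
have -> : \row_i grad (metric_coord g a) (fun_coord f a) i (t, coord a p) =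
   v *m invmx (metric_coord g a (t, coord a p)).
  have [sP _] := posdef_inv pa.
  apply/matrixP => o i; rewrite !mxE; apply: eq_bigr => j _; rewrite !mxE mulrC.
  by congr (_ * _); rewrite -[in LHS]sP mxE.
rewrite Eg; set A := metric_coord _ _ _ in pa *.
rewrite mulmxKV; last exact: posdef_unit.
by rewrite trmx_mul trmx_inv; have [-> _] := pa; rewrite mulmxA.
Qed.

Lemma global_energy_ge0 t p : lifespan Tc t -> 0 <= global_energy t p.
Proof.
move=> Lt; rewrite /global_energy.
have ap : chart_dom (coord (chart_at p)) p by exact: chart_atP.
have pa := metric_posdef flow Lt (chart_funS ap).
by apply: (energy_ge0 (D := [set z | posdef (metric_coord g (chart_at p) z)])).
Qed.

End Flow.
End ChartChange.

(** * Continuity of the energy density on a compact time interval *)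

Section CvgMatrix.
Context {R : realType} {T : Type} {F : set_system T} {FF : Filter F}.

Lemma cvg_bigsum (I : Type) (r : seq I) (P : pred I) (u : I -> T -> R) (l : I -> R) :
  (forall i, u i x @[x --> F] --> l i) ->
  \sum_(i <- r | P i) u i x @[x --> F] --> \sum_(i <- r | P i) l i.
Proof.
move=> ul; elim: r => [|i r IH].
  under eq_fun do rewrite big_nil.
  by rewrite big_nil; exact: cvg_cst.
under eq_fun do rewrite big_cons.
rewrite big_cons; case: (P i) => //.
exact: cvgD (ul i) IH.
Qed.

Lemma cvg_bigprod (I : Type) (r : seq I) (u : I -> T -> R) (l : I -> R) :
  (forall i, u i x @[x --> F] --> l i) ->
  \prod_(i <- r) u i x @[x --> F] --> \prod_(i <- r) l i.
Proof.
move=> ul; elim: r => [|i r IH].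
  under eq_fun do rewrite big_nil.
  by rewrite big_nil; exact: cvg_cst.
under eq_fun do rewrite big_cons.
by rewrite big_cons; exact: cvgM (ul i) IH.
Qed.

Lemma cvg_det n (G : T -> 'M[R]_n) (A : 'M[R]_n) :
  (forall i j, G x i j @[x --> F] --> A i j) -> \det (G x) @[x --> F] --> \det A.
Proof.
move=> GA; rewrite /determinant; apply: cvg_bigsum => s.
by apply: cvgM; [exact: cvg_cst|exact: cvg_bigprod].
Qed.

Lemma cvg_invmx n (G : T -> 'M[R]_n) (A : 'M[R]_n) :
  (forall i j, G x i j @[x --> F] --> A i j) -> A \in unitmx ->
  (\forall x \near F, G x \in unitmx) ->
  forall i j, invmx (G x) i j @[x --> F] --> invmx A i j.
Proof.
move=> GA uA uG i j.
have H : (\det (G x))^-1 * (\adj (G x)) i j @[x --> F] --> invmx A i j.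
  rewrite /invmx uA mxE; apply: cvgM.
    apply: cvgV; last exact: cvg_det.
    by rewrite -unitfE -unitmxE.
  under eq_fun do rewrite mxE /cofactor.
  rewrite mxE /cofactor; apply: cvgM; first exact: cvg_cst.
  apply: cvg_det => k l.
  under eq_fun do rewrite !mxE.
  by rewrite !mxE; exact: GA.
apply: cvg_trans H; apply: near_eq_cvg; apply: filterS uG => x uGx.
by rewrite /invmx uGx !mxE.
Qed.

End CvgMatrix.

Section Continuity.
Context {R : realType} {n : nat} (M : smoothManifold R n).
Variables (Tc : \bar R) (g : R -> tensor_field M) (f : R -> M -> R).
Hypothesis flow : ricci_flow Tc g.
Implicit Types (a b : atlas M) (p : M) (t : R) (y : 'rV[R]_n).
Variables (S T : R).
Hypotheses (S0 : 0 <= S) (TTc : (T%:E < Tc)%E).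

(** The time interval [S, T]. *)
Definition times : set R := [set t | S <= t <= T].

(** The spatial differential of f exists and is continuous on [S, T] x M.  This
holds if S > 0, and is the additional assumption made when S = 0. *)
Definition C1_on_times : Prop := forall a (i : 'I_n), exists H : R * 'rV[R]_n -> R,
    {within times `*` chart_cod (coord a), continuous H} /\
    forall t y, times t -> chart_cod (coord a) y ->
      is_derive y (delta_mx 0 i) (in_coord a (f t)) (H (t, y)).

Hypothesis C1f : C1_on_times.

Lemma times_lifespan : times `<=` lifespan Tc.
Proof.
move=> t /= /andP[St tT]; split; first exact: le_trans S0 St.
by apply: le_lt_trans TTc; rewrite lee_fin.
Qed.

Lemma C1_on_times_C1 t : times t -> C1 (f t).
Proof.
move=> It b j y cy; have [H [cH dH]] := C1f b j.
have [dFy Ey] := dH t y It cy; split => //.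
rewrite /prop_for /continuous_at Ey.
have := (subspace_continuousP _ _).1 cH (t, y) (conj It cy).
move=> HA A /HA HA'.
have N : \forall z \near y, (times `*` chart_cod (coord b)) (t, z) -> A (H (t, z)).
  have N0 : nbhs (t, y) (fun z => (times `*` chart_cod (coord b)) z -> A (H z)) by exact: HA'.
  exact: (@pair_cvg _ _ t y _ N0).
have N2 : \forall z \near y, chart_cod (coord b) z.
  by apply: open_nbhs_nbhs; split=> //; exact: chart_cod_open.
suff : \forall z \near y, A ('D_(delta_mx 0 j) (in_coord b (f t)) z) by [].
apply: filterS2 N N2 => z Nz cz; have [_ ->] := dH t z It cz.
exact: Nz.
Qed.

Lemma continuous_local_energy a :
  {within times `*` chart_cod (coord a), continuous (local_energy g f a)}.
Proof.
have [H HP] := choice (C1f a).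
apply/subspace_continuousP => -[t y] [/= It cy].
set K := times `*` chart_cod (coord a).
have Kty : K (t, y) by [].
pose W z := \sum_l (\sum_m invmx (metric_coord g a z) l m * H m z) * H l z.
have EW z : K z -> local_energy g f a z = W z.
  case: z => s z [/= Is cz].
  have E l : 'D_(axis l) (fun_coord f a) (s, z) = H l (s, z).
    rewrite -(derive_space (fun_coord f a)); have [_ dH] := HP l.
    by have [_ <-] := dH s z Is cz.
  rewrite /local_energy /energy /W; apply: eq_bigr => l _; rewrite E; congr (_ * _).
  by rewrite /grad; apply: eq_bigr => m _; rewrite E.
have Hc l : H l z @[z --> within K (nbhs (t, y))] --> H l (t, y).
  by have [cH _] := HP l; exact: ((subspace_continuousP _ _).1 cH (t, y) Kty).
have Gc i j : metric_coord g a z i j @[z --> within K (nbhs (t, y))] --> metric_coord g a (t, y) i j.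
  have [_ /(_ a i j) sG _] := flow.
  have [cG _] := sG 0%N.
  have sub : K `<=` lifespan Tc `*` chart_cod (coord a).
    by move=> [s z] [/= /times_lifespan Is cz].
  have := (subspace_continuousP _ _).1 cG (t, y) (sub _ Kty).
  apply: cvg_trans; apply: cvg_app.
  exact: within_subset.
have WW : W z @[z --> within K (nbhs (t, y))] --> W (t, y).
  apply: cvg_bigsum => l; apply: cvgM => //.
  apply: cvg_bigsum => m; apply: cvgM => //.
  apply: cvg_invmx => //.
    by apply: posdef_unit; apply: (metric_posdef flow) => //; exact: times_lifespan.
  have : \forall z \near within K (nbhs (t, y)), K z by exact: withinT.
  apply: filterS => -[s z] [/= Is cz].
  by apply: posdef_unit; apply: (metric_posdef flow) => //; exact: times_lifespan.
rewrite -(EW _ Kty) in WW.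
apply: cvg_trans WW; apply: near_eq_cvg.
have : \forall z \near within K (nbhs (t, y)), K z by exact: withinT.
by apply: filterS => z Kz; exact: (esym (EW z Kz)).
Qed.

Lemma continuous_global_energy :
  {within times `*` [set: M], continuous (fun z : R * M => global_energy g f z.1 z.2)}.
Proof.
apply/subspace_continuousP => -[t0 p0] [/= It0 _].
set a := chart_at p0.
have ap0 : chart_dom (coord a) p0 by exact: chart_atP.
have K0 : (times `*` chart_cod (coord a)) (t0, coord a p0).
  by split=> //; exact: chart_funS.
have glob t p : times t -> chart_dom (coord a) p ->
    global_energy g f t p = local_energy g f a (t, coord a p).
  move=> It ap; apply: (global_energyE flow) => //; first exact: times_lifespan.
  exact: C1_on_times_C1.
have := (subspace_continuousP _ _).1 (@continuous_local_energy a) _ K0.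
move=> HA A A0; have {}A0 : nbhs (global_energy g f t0 p0) A by exact: A0.
rewrite glob // in A0; have HA' := HA _ A0.
have dom_near : \forall p \near p0, chart_dom (coord a) p.
  by apply: open_nbhs_nbhs; split=> //; exact: chart_dom_open.
have cphi : coord a p @[p --> p0] --> coord a p0.
  have H : {within chart_dom (coord a), continuous (coord a)}.
    exact: chart_fun_continuous.
  rewrite continuous_open_subspace in H; last exact: chart_dom_open.
  by apply: H; rewrite inE.
have [[B C] /= [nB nC] BC] : nbhs (t0, coord a p0) (fun z =>
   (times `*` chart_cod (coord a)) z -> A (local_energy g f a z)) by exact: HA'.
have nC' : \forall p \near p0, C (coord a p) by exact: cphi.
suff : \forall z \near (t0, p0), (times `*` [set: M]) z -> A (global_energy g f z.1 z.2) by [].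
exists (B, (fun p => C (coord a p) /\ chart_dom (coord a) p)).
  by split => //=; exact: filterI.
move=> [t p] [/= Bt [Cp dp]] [/= It _].
rewrite glob //; apply: (BC (t, coord a p)) => //.
by split=> //; exact: chart_funS.
Qed.

End Continuity.

(** * Maximum principle and gradient estimates *)

(** Weak maximum principle on [S, T] x X, with X compact.  The hypothesis is that
no strictly increasing affine function of time touches w from above at a time in
]S, T]. *)
Lemma weak_maximum_principle (R : realType) (X : topologicalType)
    (w : R -> X -> R) (S T m : R) :
  compact [set: X] ->
  {within times S T `*` [set: X], continuous (fun z : R * X => w z.1 z.2)} ->
  (forall t0 p0 d, S < t0 -> t0 <= T -> 0 < d ->
    (forall t p, times S T t -> w t p <= w t0 p0 + d * (t - t0)) -> False) ->
  (forall p, w S p <= m) -> forall t p, times S T t -> w t p <= m.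
Proof.
move=> cX cw absurd wS t1 p1 /= I1; rewrite leNgt; apply/negP => wm.
have /andP[St1 t1T] := I1.
have TS0 : 0 < T - S + 1 by lra.
(* d is so small that w - d (t - S) still exceeds m at (t1, p1) *)
pose d := (w t1 p1 - m) / 2 / (T - S + 1).
have d0 : 0 < d by rewrite !divr_gt0 // subr_gt0.
have dTS : d * (T - S + 1) = (w t1 p1 - m) / 2 by rewrite /d divfK // gt_eqF.
pose v (z : R * X) := w z.1 z.2 - d * (z.1 - S).
have cv : {within times S T `*` [set: X], continuous v}.
  apply: within_continuousB => //; apply: continuous_subspaceT => z.
  apply: cvgMl_tmp; apply: cvgB; last exact: cvg_cst.
  exact: cvg_fst.
have cK : compact (times S T `*` [set: X]).
  apply: compact_setX => //.
  have -> : times S T = `[S, T]%classic; last exact: segment_compact.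
  by apply/seteqP; split=> t /=; rewrite in_itv.
have [|[t0 p0] /[!inE] -[/= It0 _] Hmax] := compact_EVT_max _ cK cv.
  by exists (t1, p1).
have v1 : m < v (t1, p1).
  rewrite /v /=.
  have : d * (t1 - S) <= d * (T - S + 1) by rewrite ler_pM2l //; lra.
  rewrite dTS; lra.
have v0 : m < v (t0, p0).
  by apply: lt_le_trans v1 _; apply: Hmax; rewrite inE.
have /andP[St0 t0T] := It0.
have [E|NE] := eqVneq t0 S.
  move: v0; rewrite /v /= E subrr mulr0 subr0 => /lt_le_trans /(_ (wS p0)).
  by rewrite ltxx.
apply: (absurd t0 p0 d) => //; first by rewrite lt_neqAle eq_sym NE.
move=> t p It; have : v (t, p) <= v (t0, p0) by apply: Hmax; rewrite inE.
rewrite /v /=; set x := w t p; set y := w t0 p0; rewrite !mulrBr; lra.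
Qed.

Section Gradient.
Context {R : realType} {n : nat} (M : smoothManifold R n).
Variables (Tc : \bar R) (g : R -> tensor_field M) (f0 : M -> R) (f : R -> M -> R).
Hypothesis flow : ricci_flow Tc g.
Hypothesis heat : heat_solution Tc g f0 f.
Let V : normedModType R := (R * 'rV[R]_n)%type.

Section Combination.
Variables (S T a0 c b : R).
Hypotheses (S0 : 0 <= S) (TTc : (T%:E < Tc)%E).
Hypotheses (a00 : 0 <= a0) (c0 : 0 <= c) (cb : c <= b).

(** The function to which the maximum principle is applied. *)
Definition combination t p : R :=
  (a0 + c * (t - S)) * global_energy g f t p + b * (f t p * f t p).

(** At a touching point (t0, p0), the second derivative test in the chart at p0
contradicts the subsolution property.  Only positive times are involved. *)
Lemma combination_absurd t0 p0 d : S < t0 -> t0 <= T -> 0 < d ->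
  (forall t p, times S T t -> combination t p <= combination t0 p0 + d * (t - t0)) ->
  False.
Proof.
move=> St0 t0T d0 Hmax.
pose a := chart_at p0.
have ap0 : chart_dom (coord a) p0 by exact: chart_atP.
have t00 : 0 < t0 by exact: le_lt_trans St0.
pose D := interior_dom Tc a.
have oD : open D by exact: open_interior_dom.
have sG := smooth_metric flow a.
have pG := metric_posdef_in flow (a := a).
have sf := smooth_fun heat a.
pose y0 := coord a p0.
pose z0 : V := (t0, y0).
have Dz0 : D z0.
  split=> /=; last exact: chart_funS.
  by split=> //; apply: le_lt_trans TTc; rewrite lee_fin.
pose alpha (z : V) := a0 + c * (z.1 - S).
have lfst (h : R) (x v : V) : (h *: v + x).1 = h * v.1 + x.1 by [].
have sfst : smooth D (fun z : V => z.1).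
  by apply: smooth_linear => // z; exact: cvg_fst.
have sfS : smooth D (fun z : V => z.1 - S) by apply: smoothB => //; exact: smooth_cst.
have scf : smooth D (fun z : V => c * (z.1 - S)) by apply: smoothM => //; exact: smooth_cst.
have sal : smooth D alpha by apply: smoothD => //; exact: smooth_cst.
have dal v z : D z -> 'D_v alpha z = c * v.1.
  move=> Dz; have dc (r : R) : 'D_v (fun _ : V => r) z = 0 by exact: derive_cst.
  rewrite (dirD v Dz (smooth_cst D a0) scf) (dirZ v Dz c sfS).
  rewrite (dirB v Dz sfst (smooth_cst D S)) !dc.
  have [_ ->] := @is_derive_linear R V (fun z : V => z.1) z v lfst.
  by rewrite add0r subr0.
pose W (z : V) := alpha z * local_energy g f a z + b * (fun_coord f a z * fun_coord f a z).
have sE := smooth_energy oD sG pG sf.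
have sW : smooth D W.
  apply: smoothD => //; first exact: smoothM.
  by apply: smoothM => //; [exact: smooth_cst|exact: smoothM].
have WE t y : D (t, y) -> W (t, y) = combination t (chart_inv (coord a) y).
  move=> [/= [tp tT] cy].
  rewrite /W /combination; congr (_ * _ + _).
  rewrite (global_energyE flow (a := a)).
  - by rewrite chart_invK.
  - by split=> //; exact: ltW.
  - exact: (C1_pos heat).
  - exact: chart_invS.
have W0 : W z0 = combination t0 p0 by rewrite WE // chart_funK.
have It0 : times S T t0 by rewrite /times /= ltW.
have le0 : lap (metric_coord g a) W z0 <= 0.
  apply: (lap_max oD sG pG sW Dz0) => w.
  have : \forall h \near (0 : R), D (z0 + h *: ((0, w) : V)) by exact: open_line.
  apply: filterS => h.
  have -> : z0 + h *: ((0, w) : V) = (t0, y0 + h *: w).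
    by apply: injective_projections; rewrite /= ?scaler0 ?addr0.
  move=> Dh; rewrite WE // W0.
  by have := Hmax t0 (chart_inv (coord a) (y0 + h *: w)) It0; rewrite subrr mulr0 addr0.
have sub : 'D_time W z0 <= 2^-1 * lap (metric_coord g a) W z0.
  apply: (combined_subsolution oD sG pG sf) => //.
  - by move=> z i j Dz; exact: (flow_coord flow).
  - by move=> z Dz; exact: (heat_coord heat).
  - by move=> i y Dy; rewrite dal //= mulr0.
  - by rewrite /alpha /= addr_ge0 // mulr_ge0 // subr_ge0 ltW.
  - by rewrite dal //= mulr1.
have ge : d <= 'D_time W z0.
  have dW := derivableP (smooth_derivable (v := time) sW Dz0).
  apply: (derive_left_ge dW).
  have N1 : \forall h \near (0 : R), D (z0 + h *: time) by exact: open_line.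
  have N2 : \forall h \near (0 : R), S - t0 < h.
    by apply: open_nbhs_nbhs; split; [exact: open_gt|rewrite /= subr_lt0].
  apply: filterS2 N1 N2 => h Dh Sh h0.
  have E : z0 + h *: time = (t0 + h, y0).
    by apply: injective_projections; rewrite /= ?scaler0 ?addr0 // [_ *: 1]mulr1.
  rewrite E in Dh *; rewrite WE // W0 chart_funK //.
  have := Hmax (t0 + h) p0; rewrite (_ : t0 + h - t0 = h); last lra.
  apply.
  by apply/andP; split; lra.
have := lt_le_trans d0 (le_trans ge sub).
by rewrite pmulr_rgt0 ?invr_gt0 // => /lt_le_trans/(_ le0); rewrite ltxx.
Qed.

Lemma continuous_fun :
  {within times S T `*` [set: M], continuous (fun z : R * M => f z.1 z.2)}.
Proof.
have [_ cf _ _] := heat.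
apply: continuous_subspaceW cf => -[t p] [/= It _]; split => //=.
exact: (times_lifespan S0 TTc).
Qed.

Lemma continuous_combination : C1_on_times f S T ->
  {within times S T `*` [set: M], continuous (fun z : R * M => combination z.1 z.2)}.
Proof.
move=> C1f.
have /subspace_continuousP cE := continuous_global_energy flow S0 TTc C1f.
have /subspace_continuousP cf := continuous_fun.
apply/subspace_continuousP => z Kz; rewrite /combination.
have cfst : (fun z : R * M => z.1) @ within (times S T `*` [set: M]) (nbhs z) --> z.1.
  case: z {Kz} => t p; apply: cvg_trans (@cvg_fst _ _ (nbhs t) (nbhs p) _).
  by apply: cvg_app; exact: cvg_within.
apply: cvgD.
  apply: cvgM; last exact: cE.
  apply: cvgD; first exact: cvg_cst.
  apply: cvgMl_tmp; apply: cvgB; last exact: cvg_cst.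
  exact: cfst.
by apply: cvgMl_tmp; apply: cvgM; exact: cf.
Qed.

End Combination.

Lemma C1_on_times_pos (S T : R) : 0 < S -> (T%:E < Tc)%E -> C1_on_times f S T.
Proof.
move=> S0 TTc a i; exists ('D_(axis i) (fun_coord f a)).
have sf := smooth_fun heat a.
have inD t y : times S T t -> chart_cod (coord a) y -> interior_dom Tc a (t, y).
  move=> /andP[St tT] cy; split=> //=; split; first exact: lt_le_trans St.
  by apply: le_lt_trans TTc; rewrite lee_fin.
split.
  apply/subspace_continuousP => -[t y] [/= It cy].
  have H := smooth_continuous (smooth_derive (axis i) sf) (inD t y It cy).
  by apply: cvg_trans H; apply: cvg_app; exact: cvg_within.
move=> t y It cy; rewrite -(derive_space (fun_coord f a)); apply: derivableP.
exact: (derivable_space (F := fun_coord f a) (smooth_derivable sf (inD t y It cy))).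
Qed.

Lemma C1_on_times_0 (T : R) : (T%:E < Tc)%E -> spatially_C1_up_to_0 Tc f -> C1_on_times f 0 T.
Proof.
move=> TTc C1f a i; have [H [cH dH]] := C1f a i.
have sub := times_lifespan (lexx 0) TTc.
exists H; split; last by move=> t y /sub Lt cy; exact: dH.
by apply: continuous_subspaceW cH => -[t p] [/= /sub It cy].
Qed.

Hypothesis cM : compact [set: M].

(** Maximum principle for |grad f|^2. *)
Lemma global_energy_le (S T m : R) : 0 <= S -> S <= T -> (T%:E < Tc)%E ->
  C1_on_times f S T -> (forall p, global_energy g f S p <= m) ->
  forall p, global_energy g f T p <= m.
Proof.
move=> S0 ST TTc C1f Hm p.
have E t q : combination S 1 0 0 t q = global_energy g f t q.
  rewrite /combination; ring.
have cw : {within times S T `*` [set: M],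
    continuous (fun z : R * M => combination S 1 0 0 z.1 z.2)}.
  exact: continuous_combination.
rewrite -E; apply: (weak_maximum_principle cM cw).
- by apply: combination_absurd.
- by move=> q; rewrite E.
- by rewrite /times /= ST lexx.
Qed.

(** Maximum principle for f^2; no differentiability at time 0 is needed. *)
Lemma sqr_fun_le (T m : R) : 0 <= T -> (T%:E < Tc)%E ->
  (forall p, f0 p * f0 p <= m) -> forall p, f T p * f T p <= m.
Proof.
move=> T0 TTc Hm p.
have E t q : combination 0 0 0 1 t q = f t q * f t q.
  rewrite /combination; ring.
rewrite -E; apply: (@weak_maximum_principle _ _ _ 0 T m cM).
- have -> : (fun z : R * M => combination 0 0 0 1 z.1 z.2) = (fun z => f z.1 z.2 * f z.1 z.2).
    by apply/funext => z; exact: E.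
  have /subspace_continuousP cf := continuous_fun (lexx 0) TTc.
  by apply/subspace_continuousP => z Kz; apply: cvgM; exact: cf.
- by apply: combination_absurd.
- by move=> q; rewrite E; have [-> _ _ _] := heat.
- by rewrite /times /= T0 lexx.
Qed.

(** T |grad f(T,.)|^2 <= sup f_0^2. *)
Lemma energy_decay (T m : R) : 0 < T -> (T%:E < Tc)%E ->
  (forall p, f0 p * f0 p <= m) -> forall p, T * global_energy g f T p <= m.
Proof.
move=> T0 TTc Hm p; set Q := global_energy _ _ _ _.
have Q0 : 0 <= Q.
  by apply: (global_energy_ge0 _ flow); split=> //; exact: ltW.
(* |grad f|^2 may be unbounded near time 0: start at a time e > 0 *)
have H e : 0 < e -> e < T -> (T - e) * Q <= m.
  move=> e0 eT.
  have eTc : (e%:E < Tc)%E by apply: lt_trans TTc; rewrite lte_fin.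
  have He := sqr_fun_le (ltW e0) eTc Hm.
  have C1f := C1_on_times_pos e0 TTc.
  suff : combination e 0 1 1 T p <= m.
    rewrite /combination add0r !mul1r -/Q; apply: le_trans.
    by rewrite lerDl -expr2 sqr_ge0.
  have cw : {within times e T `*` [set: M],
      continuous (fun z : R * M => combination e 0 1 1 z.1 z.2)}.
    by apply: continuous_combination => //; exact: ltW.
  apply: (weak_maximum_principle cM cw).
  - by apply: combination_absurd => //; exact: ltW.
  - by move=> q; rewrite /combination subrr mulr0 addr0 mul0r add0r mul1r.
  - by rewrite /times /= (ltW eT) lexx.
rewrite leNgt; apply/negP => mTQ.
have m0 : 0 <= m by apply: le_trans (Hm p); rewrite -expr2 sqr_ge0.
have Qp : 0 < Q.
  rewrite lt_neqAle Q0 andbT eq_sym; apply/eqP => Q00.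
  by move: mTQ; rewrite Q00 mulr0; lra.
(* chosen so that (T - e) Q is half-way between m and T Q *)
pose e := (T * Q - m) / 2 / Q.
have e0 : 0 < e by rewrite !divr_gt0 // subr_gt0.
have eQ : e * Q = (T * Q - m) / 2 by rewrite /e divfK // gt_eqF.
have eT : e < T.
  by rewrite -(ltr_pM2r Qp) eQ; lra.
have := H e e0 eT; rewrite mulrBl eQ; lra.
Qed.

End Gradient.

Theorem corollary3p5 (R : realType) (n : nat) (M : smoothManifold R n)
    (Tc : \bar R) (g : R -> tensor_field M) (f0 : M -> R) (f : R -> M -> R) :
  compact [set: M] -> connected [set: M] ->
  maximal_ricci_flow Tc g ->
  heat_solution Tc g f0 f ->
  (forall S T : R, 0 <= S -> S <= T -> (T%:E < Tc)%E ->
     (S = 0 -> spatially_C1_up_to_0 Tc f) ->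
     (sup_gradient_norm (g T) (f T) <= sup_gradient_norm (g S) (f S))%E) /\
  (forall T : R, 0 < T -> (T%:E < Tc)%E ->
     (sup_gradient_norm (g T) (f T) <= sup_norm f0 * ((Num.sqrt T)^-1)%:E)%E).
Proof.
move=> cM _ [_ flow _] heat.
have life (t T : R) : 0 <= t -> t <= T -> (T%:E < Tc)%E -> lifespan Tc t.
  by move=> t0 tT TTc; split=> //; apply: le_lt_trans TTc; rewrite lee_fin.
split=> [S T S0 ST TTc C1f|T T0 TTc].
  have LS := life S T S0 ST TTc.
  have LT := life T T (le_trans S0 ST) (lexx T) TTc.
  have C1t : C1_on_times f S T.
    have [S00|S00] := eqVneq S 0.
      by rewrite S00; apply: (C1_on_times_0 TTc); exact: C1f.
    by apply: (C1_on_times_pos heat) => //; rewrite lt_neqAle eq_sym S00.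
  apply: ge_ereal_sup => _ [p _ <-].
  have ub q : ((gradient_norm (g S) (f S) q)%:E <= sup_gradient_norm (g S) (f S))%E.
    by apply: ereal_sup_ubound; exists q.
  case E: (sup_gradient_norm (g S) (f S)) ub => [r| |] ub.
  - have ubQ q : global_energy g f S q <= r * r.
      have := ub q; rewrite lee_fin (gradient_normE f flow) // => H.
      rewrite -(sqr_sqrtr (global_energy_ge0 f flow q LS)) expr2.
      by apply: ler_pM => //; exact: sqrtr_ge0.
    have r0 : 0 <= r.
      by have := ub p; rewrite lee_fin; apply: le_trans; rewrite (gradient_normE f flow) // sqrtr_ge0.
    have := global_energy_le flow heat cM S0 ST TTc C1t ubQ p.
    rewrite lee_fin (gradient_normE f flow) // => H.
    rewrite -(ger0_norm r0) -sqrtr_sqr ler_wsqrtr // expr2.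
  - by rewrite leey.
  - by have := ub p; rewrite leeNy_eq.
have LT := life T T (ltW T0) (lexx T) TTc.
apply: ge_ereal_sup => _ [p _ <-].
have ub q : ((`|f0 q|)%:E <= sup_norm f0)%E by apply: ereal_sup_ubound; exists q.
have sT : 0 < Num.sqrt T by rewrite sqrtr_gt0.
case E: (sup_norm f0) ub => [r| |] ub.
- have r0 : 0 <= r by have := ub p; rewrite lee_fin; apply: le_trans.
  have ubf q : f0 q * f0 q <= r * r.
    rewrite -expr2 -real_normK ?num_real // expr2.
    by have := ub q; rewrite lee_fin => H; apply: ler_pM.
  have H := energy_decay flow heat cM T0 TTc ubf p.
  rewrite -EFinM lee_fin (gradient_normE f flow) // ler_pdivlMr //.
  rewrite -sqrtrM ?(global_energy_ge0 f flow p LT) // -(ger0_norm r0) -sqrtr_sqr.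
  by rewrite ler_wsqrtr // mulrC expr2.
- by rewrite gt0_mulye ?leey // lte_fin invr_gt0.
- by have := ub p; rewrite leeNy_eq.
Qed.
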